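(* Let $q$ be a prime power, let $S\subseteq\mathbb P^1$ be a finite set of $\mathbb F_q$-rational places containing $B=\{0,\infty\}$, and let $S_0=S\setminus B$. Then the orbifold degree of $\Gamma_S$ is $N_0(\Gamma_S)=1$, and $\Gamma_S$ acts simply transitively on the vertices of $\mathbf T_{S_0}$.
   Context: Let $K=\mathbb F_q(t)$ be the function field of $\mathbb P^1$ over $\mathbb F_q$. If $q$ is odd, fix a non-square $c\in\mathbb F_q$ and let $D=K\{Z,F\}/(Z^2=c,\ F^2=t,\ FZ=-ZF)$. If $q$ is even, fix $c\in\mathbb F_q$ with $X^2+X+c$ irreducible over $\mathbb F_q$ and let $D=K\{Z,F\}/(Z^2+Z=c,\ F^2=t,\ FZ=(Z+1)F)$. In both cases $D$ is a quaternion algebra over $K$ ramified exactly at $B=\{0,\infty\}$. The subring $\mathbb F_q[Z]=\mathbb F_q\oplus\mathbb F_qZ\subseteq D$ is a field with $q^2$ elements; $N(\alpha)=\alpha\bar\alpha$ is its norm to $\mathbb F_q$, and $F\alpha=\bar\alpha F$. For a finite set of places $S\supseteq B$ put $S_0=S\setminus B$, let $\mathfrak o_{K,S}$ be the ring of $S$-integers, $\mathcal A(\mathfrak o_{K,S})=\mathfrak o_{K,S}\oplus\mathfrak o_{K,S}Z\oplus\mathfrak o_{K,S}F\oplus\mathfrak o_{K,S}FZ\subseteq D$, and $\Lambda_S=\mathcal A(\mathfrak o_{K,S})^\times/\mathfrak o_{K,S}^\times$. Write $[w]$ for the class of $w$. A rational place other than $0,\infty$ is given by $\tau\in\mathbb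 F_q^\times$. Put $PA_\tau=\{[1+\alpha F]:\alpha\in\mathbb F_q[Z],\ N(\alpha)=\tau^{-1}\}$. For $S$ consisting of rational places, $\Gamma_S\subseteq\Lambda_S$ is the subgroup generated by all $PA_\tau$, $\tau\in S_0$. For $v\in S_0$ let $K_v$ be the completion at $v$ and $\mathcal T_v$ the Bruhat–Tits tree of $(D\otimes_KK_v)^\times/K_v^\times\simeq\mathrm{PGL}_2(K_v)$. $\Lambda_S$ acts on $\mathbf T_{S_0}=\prod_{v\in S_0}\mathcal T_v$ via $\Lambda_S\hookrightarrow\prod_{v\in S_0}\mathrm{PGL}_2(K_v)$. For a subgroup $\Gamma$ of finite index in $\Lambda_S$ the orbifold degree is $N_0(\Gamma)=\sum_P 1/\#\Gamma_P$, the sum over vertices $P$ of $\Gamma\backslash\mathbf T_{S_0}$, where $\Gamma_P$ is the stabiliser in $\Gamma$ of a vertex of $\mathbf T_{S_0}$ representing $P$. *)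

(* Defs.v *)
From HB Require Import structures.
From mathcomp Require Import all_boot all_order all_algebra.
From mathcomp Require Import ring.
From mathcomp Require Import finmap boolp classical_sets cardinality fsbigop.

Set Implicit Arguments.
Unset Strict Implicit.
Unset Printing Implicit Defensive.

Import Order.TTheory GRing.Theory Num.Theory.
Local Open Scope classical_set_scope.
Local Open Scope ring_scope.

(* [quat e c t] is the free R-algebra on 1, Z, F, FZ with Z^2 = eZ + c,
   F^2 = t and FZ = (e - Z)F.  An element is alpha + F beta with alpha, beta in
   R[Z]; since F alpha = conj(alpha) F, the product is
     (alpha + F beta)(gamma + F delta)
       = (alpha gamma + t conj(beta) delta) + F (conj(alpha) delta + beta gamma).
   Over F_q(t), e = 0 is the presentation used for q odd, and e = 1 the one used
   for q even, see [quat_odd] and [quat_even]. *)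
Record quat (R : comNzRingType) (e c t : R) := Quat {
  coef1 : R; coefZ : R; coefF : R; coefFZ : R }.

Section Quaternion.
Variables (R : comNzRingType) (e c t : R).
Local Notation Q := (quat e c t).

Definition quat_tuple (x : Q) := (coef1 x, coefZ x, coefF x, coefFZ x).
Definition tuple_quat (x : R * R * R * R) : Q :=
  Quat e c t x.1.1.1 x.1.1.2 x.1.2 x.2.
Lemma quat_tupleK : cancel quat_tuple tuple_quat. Proof. by case. Qed.
HB.instance Definition _ := Choice.copy Q (can_type quat_tupleK).

Definition quat_zero : Q := Quat e c t 0 0 0 0.
Definition quat_opp (x : Q) : Q :=
  Quat e c t (- coef1 x) (- coefZ x) (- coefF x) (- coefFZ x).
Definition quat_add (x y : Q) : Q :=
  Quat e c t (coef1 x + coef1 y) (coefZ x + coefZ y)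
             (coefF x + coefF y) (coefFZ x + coefFZ y).

Lemma quat_addA : associative quat_add.
Proof. by case=> ????[????][????]; rewrite /quat_add /= !addrA. Qed.
Lemma quat_addC : commutative quat_add.
Proof. by case=> ????[????]; congr Quat; exact: addrC. Qed.
Lemma quat_add0 : left_id quat_zero quat_add.
Proof. by case=> ????; rewrite /quat_add /= !add0r. Qed.
Lemma quat_addN : left_inverse quat_zero quat_opp quat_add.
Proof. by case=> ????; rewrite /quat_add /= !addNr. Qed.
HB.instance Definition _ :=
  GRing.isZmodule.Build Q quat_addA quat_addC quat_add0 quat_addN.

Definition quat_one : Q := Quat e c t 1 0 0 0.
Definition quat_mul (x y : Q) : Q :=
  let: Quat a0 a1 a2 a3 := x in let: Quat b0 b1 b2 b3 := y in
  Quat e c t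
    (a0 * b0 + c * (a1 * b1) + t * ((a2 + e * a3) * b2 - c * (a3 * b3)))
    (a0 * b1 + a1 * b0 + e * (a1 * b1) + t * (a2 * b3 - a3 * b2))
    ((a0 + e * a1) * b2 - c * (a1 * b3) + (a2 * b0 + c * (a3 * b1)))
    (a0 * b3 - a1 * b2 + (a2 * b1 + a3 * b0 + e * (a3 * b1))).

Lemma quat_mulA : associative quat_mul.
Proof. by case=> ????[????][????]; rewrite /quat_mul; congr Quat; ring. Qed.
Lemma quat_mul1x : left_id quat_one quat_mul.
Proof. by case=> ????; rewrite /quat_mul /=; congr Quat; ring. Qed.
Lemma quat_mulx1 : right_id quat_one quat_mul.
Proof. by case=> ????; rewrite /quat_mul /=; congr Quat; ring. Qed.
Lemma quat_mulDl : left_distributive quat_mul +%R.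
Proof.
by case=> ????[????][????]; rewrite /quat_mul /= /quat_add; congr Quat => /=; ring.
Qed.
Lemma quat_mulDr : right_distributive quat_mul +%R.
Proof.
by case=> ????[????][????]; rewrite /quat_mul /= /quat_add; congr Quat => /=; ring.
Qed.
Lemma quat_1neq0 : quat_one != 0.
Proof. by apply/eqP => -[/eqP]; rewrite oner_eq0. Qed.
HB.instance Definition _ := GRing.Zmodule_isNzRing.Build Q
  quat_mulA quat_mul1x quat_mulx1 quat_mulDl quat_mulDr quat_1neq0.

Definition quat_scale (k : R) (x : Q) : Q :=
  Quat e c t (k * coef1 x) (k * coefZ x) (k * coefF x) (k * coefFZ x).
Lemma quat_scaleA a b (x : Q) :
  quat_scale a (quat_scale b x) = quat_scale (a * b) x.
Proof. by congr Quat; rewrite /= mulrA. Qed.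
Lemma quat_scale1 : left_id 1 quat_scale.
Proof. by case=> ????; rewrite /quat_scale /= !mul1r. Qed.
Lemma quat_scaleDr : right_distributive quat_scale +%R.
Proof. by move=> k [????][????]; congr Quat; rewrite /= mulrDr. Qed.
Lemma quat_scaleDl (x : Q) : {morph quat_scale^~ x : a b / a + b}.
Proof. by move=> a b; congr Quat; rewrite /= mulrDl. Qed.
HB.instance Definition _ := GRing.Zmodule_isLmodule.Build R Q
  quat_scaleA quat_scale1 quat_scaleDr quat_scaleDl.

Lemma quat_scaleAl (k : R) (x y : Q) : k *: (x * y) = (k *: x) * y.
Proof. by case: x y => ????[????]; congr Quat => /=; ring. Qed.
HB.instance Definition _ := GRing.Lmodule_isLalgebra.Build R Q quat_scaleAl.
Lemma quat_scaleAr (k : R) (x y : Q) : k *: (x * y) = x * (k *: y).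
Proof. by case: x y => ????[????]; congr Quat => /=; ring. Qed.
HB.instance Definition _ := GRing.Lalgebra_isAlgebra.Build R Q quat_scaleAr.

Definition genZ : Q := Quat e c t 0 1 0 0.
Definition genF : Q := Quat e c t 0 0 1 0.

(* The standard involution, with quat_conj Z = e - Z and quat_conj F = - F. *)
Definition quat_conj (x : Q) : Q :=
  Quat e c t (coef1 x + e * coefZ x) (- coefZ x) (- coefF x) (- coefFZ x).

Lemma quat_basis (x : Q) :
  x = coef1 x *: 1 + coefZ x *: genZ + coefF x *: genF + coefFZ x *: (genF * genZ).
Proof. by case: x => ????; congr Quat => /=; ring. Qed.

Lemma conjM (x y : Q) : quat_conj (x * y) = quat_conj y * quat_conj x.
Proof. by case: x y => ????[????]; congr Quat => /=; ring. Qed.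

Lemma genF_conj (a b : R) :
  genF * (a *: 1 + b *: genZ) = quat_conj (a *: 1 + b *: genZ) * genF.
Proof. by congr Quat => /=; ring. Qed.

End Quaternion.

Lemma quat_odd (R : comNzRingType) (c t : R) (Z := genZ 0 c t) (F := genF 0 c t) :
  [/\ Z ^+ 2 = c%:A, F ^+ 2 = t%:A & F * Z = - Z * F].
Proof. by split; congr Quat => /=; ring. Qed.

Lemma quat_even (R : comNzRingType) (c t : R) (Z := genZ 1 c t) (F := genF 1 c t) :
  2%N \in [pchar R] ->
  [/\ Z ^+ 2 + Z = c%:A, F ^+ 2 = t%:A & F * Z = (Z + 1) * F].
Proof.
move=> R2; have N1 : -1 = 1 :> R by rewrite oppr_pchar2.
have R20 : 1 + 1 = 0 :> R by rewrite -{1}N1 addNr.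
split; congr Quat => /=; ring: N1 R20.
Qed.

Definition quat_map (R R' : comNzRingType) (f : R -> R') (e c t : R)
    (x : quat e c t) : quat (f e) (f c) (f t) :=
  Quat _ _ _ (f (coef1 x)) (f (coefZ x)) (f (coefF x)) (f (coefFZ x)).

Section FunctionField.
Variable Fq : finFieldType.
Local Notation K := {fraction {poly Fq}}.

Definition constK (a : Fq) : K := tofrac a%:P.
Definition tK : K := tofrac 'X.

(* [Some p] is the place of the monic irreducible polynomial p, and [None] is
   the place at infinity. *)
Definition place := option {poly Fq}.
Definition is_place (v : place) : Prop :=
  if v is Some p then p \is monic /\ irreducible_poly p else True.

Definition multiplicity (p f : {poly Fq}) : nat :=
  \max_(n < size f | p ^+ n %| f) n.

(* The normalised valuation of v; its value at 0 is irrelevant. *)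
Definition ord (v : place) (x : K) : int :=
  let: (f, g) := (\n_(repr x), \d_(repr x)) in
  if v is Some p then (multiplicity p f)%:Z - (multiplicity p g)%:Z
  else (size g)%:Z - (size f)%:Z.

(* The F_q-rational points of P^1, infinity being [None]. *)
Definition rational_place (P : option Fq) : place :=
  omap (fun a => 'X - a%:P) P.

Definition val_ge (L : zmodType) (val : L -> int) (n : int) (x : L) : Prop :=
  x = 0 \/ n <= val x.

Record completion (v : place) := Completion {
  cfield :> fieldType;
  cembed : {rmorphism K -> cfield};
  cval : cfield -> int;
  cval_embed : forall x : K, x != 0 -> cval (cembed x) = ord v x;
  cvalM : forall x y, x != 0 -> y != 0 -> cval (x * y) = cval x + cval y;
  cvalD : forall n x y, val_ge cval n x -> val_ge cval n y ->
    val_ge cval n (x + y);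
  cdense : forall (x : cfield) (n : int),
    exists y : K, val_ge cval n (x - cembed y);
  ccomplete : forall u : nat -> cfield,
    (forall n, exists N, forall i j, (N <= i)%N -> (N <= j)%N ->
      val_ge cval n (u i - u j)) ->
    exists l, forall n, exists N, forall i, (N <= i)%N -> val_ge cval n (u i - l)
}.

Definition eK : K := if odd #|Fq| then 0 else 1.

Definition admissible (c : Fq) : Prop :=
  if odd #|Fq| then forall x : Fq, x ^+ 2 != c
  else irreducible_poly ('X^2 + 'X + c%:P).

Definition placesB : {set option Fq} := [set Some 0; None].
Definition S0 (S : {set option Fq}) : {set option Fq} := S :\: placesB.

Definition S_integer (S : {set option Fq}) : set K := [set x |
  forall v, is_place v -> (forall P, P \in S -> v <> rational_place P) ->
    val_ge (ord v) 0 x].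
Definition S_unit (S : {set option Fq}) : set K :=
  [set k | k != 0 /\ S_integer S k /\ S_integer S k^-1].

Section Lattice.
Variable c : Fq.

Definition D := quat eK (constK c) tK.
HB.instance Definition _ := GRing.Algebra.on D.

Definition ZD : D := genZ eK (constK c) tK.
Definition FD : D := genF eK (constK c) tK.

Definition orderA (S : {set option Fq}) : set D := [set w |
  [/\ S_integer S (coef1 w), S_integer S (coefZ w),
      S_integer S (coefF w) & S_integer S (coefFZ w)]].
Definition orderA_unit (S : {set option Fq}) : set D := [set w |
  orderA S w /\ exists w', [/\ orderA S w', w * w' = 1 & w' * w = 1]].

(* Elements of the quotient group are represented as cosets, i.e. as subsets of
   D, with the group operations computed elementwise. *)
Definition coset_class (S : {set option Fq}) (w : D) : set D :=
  [set k *: w | k in S_unit S].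
Definition class_mul (A B : set D) : set D := [set x * y | x in A & y in B].
Definition class_inv (A : set D) : set D :=
  [set y | exists x, [/\ A x, x * y = 1 & y * x = 1]].

Definition Lambda (S : {set option Fq}) : set (set D) :=
  [set coset_class S w | w in orderA_unit S].

Definition is_subgroup (S : {set option Fq}) (H : set (set D)) : Prop :=
  [/\ H `<=` Lambda S, H (coset_class S 1),
      forall A B, H A -> H B -> H (class_mul A B)
    & forall A, H A -> H (class_inv A)].

Definition FqZ : set D :=
  [set (constK a)%:A + constK b *: ZD | a in setT & b in setT].
Definition PA (S : {set option Fq}) (tau : Fq) : set (set D) :=
  [set coset_class S (1 + alpha * FD) | alpha in
    [set alpha | FqZ alpha /\ alpha * quat_conj alpha = (constK tau^-1)%:A]].

Definition Gamma (S : {set option Fq}) : set (set D) :=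
  smallest (is_subgroup S) (\bigcup_(tau in [set tau | Some tau \in S0 S]) PA S tau).

End Lattice.

(* D tensored over K with the completion Kv, i.e. the quaternion algebra over Kv
   with the same structure constants. *)
Definition Dv (c : Fq) (v : place) (Kv : completion v) :=
  quat (cembed Kv eK) (cembed Kv (constK c)) (cembed Kv tK).
HB.instance Definition _ c v (Kv : completion v) := GRing.Algebra.on (Dv c Kv).

Section Tree.
Variables (v : place) (Kv : completion v).

Definition cintegers : set Kv := [set x | val_ge (@cval v Kv) 0 x].

Definition is_lattice (L : set 'cV[Kv]_2) : Prop :=
  exists2 B : 'M[Kv]_2, B \in unitmx &
    L = [set B *m x | x in [set x : 'cV[Kv]_2 | forall i, cintegers (x i 0)]].

Definition homothety_class (L : set 'cV[Kv]_2) : set (set 'cV[Kv]_2) :=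
  [set [set k *: x | x in L] | k in [set k : Kv | k != 0]].

(* The vertices of the Bruhat-Tits tree of PGL_2. *)
Definition tree_vertex : set (set (set 'cV[Kv]_2)) :=
  [set homothety_class L | L in is_lattice].

End Tree.

Section Action.
Variables (c : Fq) (S : {set option Fq}).
Local Notation I := {P : option Fq | P \in S0 S}.
Variable Kv : forall i : I, completion (rational_place (val i)).
Variable phi : forall i : I, {lrmorphism Dv c (Kv i) -> 'M[Kv i]_2}.

Definition vertexT := forall i : I, set (set 'cV[Kv i]_2).
HB.instance Definition _ := Choice.on vertexT.

Definition T_vertex : set vertexT := [set P | forall i, tree_vertex (P i)].

(* The elements of a class differ by scalars, so any of them, and hence all of
   them together, move the homothety class P i to the same homothety class. *)
Definition act (A : set (D c)) (P : vertexT) : vertexT := fun i =>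
  [set [set phi i (quat_map (cembed (Kv i)) w) *m x | x in L]
    | w in A & L in P i].

Definition simply_transitive (G : set (set (D c))) : Prop :=
  forall P Q, T_vertex P -> T_vertex Q -> exists! g, G g /\ act g P = Q.

Definition stabiliser (G : set (set (D c))) (P : vertexT) : set (set (D c)) :=
  [set g | G g /\ act g P = P].
Definition vertex_orbit (G : set (set (D c))) (P : vertexT) : set vertexT :=
  [set act g P | g in G].
Definition quotient_vertex (G : set (set (D c))) : set (set vertexT) :=
  [set vertex_orbit G P | P in T_vertex].

(* The stabilisers of the vertices of one orbit are conjugate, so that the
   representative chosen by [xget] is irrelevant.  [fset_set] sends an infinite
   set to the empty one, hence an infinite stabiliser contributes 1/0 = 0. *)
Definition N0 (G : set (set (D c))) : rat :=
  \sum_(O \in quotient_vertex G)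
    (#|` fset_set (stabiliser G (xget (fun=> set0) O))|%:R : rat)^-1.

End Action.
End FunctionField.

Arguments Lambda {Fq} c S _.
Arguments PA {Fq} c S tau _.
Arguments Gamma {Fq} c S _.

(* Main.v *)
Require Import Defs.
From mathcomp Require Import all_boot all_order all_algebra.
From mathcomp Require pgroup abelian finfield.
From mathcomp Require Import ring zify.
From mathcomp Require Import finmap boolp classical_sets cardinality fsbigop.
Import Defs.

(** At a place [tau] of [S0] the splitting [phi] yields [u] in [K_v[Z]] of norm
    [t], hence a vector [x] killed by [F + u]; the lattice [o_v[Z] x] then has
    the order [A(o_v)] as its stabiliser in [D_v], and every vertex is the class
    of [g o_v[Z] x] for some invertible [g].

    Transitivity: take [g_v] in [A(o_v)] for all [v].  If the reduced norm of
    [g_v] is not a unit, then either [t - tau] divides [g_v], or the reduction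
    of [g_v] is killed on the left by [1 - F b] for a [b] in [F_q[Z]] with
    [N b = 1 / tau], so that [1 + F b], whose reduced norm is [1 - t / tau],
    divides [g_v] on the left.  Both divisors are units at the other places, so
    this descent on the valuations of the norms moves the standard vertex to the
    given one by elements of the sets [PA].

    Freeness: the generators [1 + alpha F] are congruent to 1 modulo [F] at
    [t = 0], so each element of Gamma has a representative in [K^* (1 + F O_0)],
    where [O_0] is the maximal order at [t = 0].  If such an element fixes the
    standard vertex, write it as a scalar times a quaternion with coprime
    polynomial coordinates.  The norm of the latter has no irreducible factor,
    so it is constant; as [N alpha - t N beta] has two summands of degrees of
    different parity, the quaternion is a constant of [F_q[Z]], and the
    congruence at [t = 0] makes it a scalar. *)

Set Implicit Arguments.
Unset Strict Implicit.
Unset Printing Implicit Defensive.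

Import Order.TTheory GRing.Theory Num.Theory.
Local Open Scope classical_set_scope.
Local Open Scope ring_scope.


(** * The p-adic valuations of the rational function field *)

(** [ord] is computed on the chosen representative [repr x]; this identity makes that representative
    comparable with any other way of writing [x] as a quotient. *)
Lemma frac_numden (R : idomainType) (x : {fraction R}) :
  x = FracField.tofrac \n_(repr x) / FracField.tofrac \d_(repr x).
Proof.
have d0 := denom_ratioP (repr x).
have dF0 : FracField.tofrac \d_(repr x) != 0 by rewrite tofrac_eq0.
apply: (mulIf dF0); rewrite divfK // -{1}[x]reprK.
move: (repr x) d0 {dF0} => r r0.
rewrite !piE; apply/eqmodP; rewrite /= FracField.equivfE /FracField.mulf.
by rewrite !numden_Ratio ?mulr1 ?oner_eq0 // mulrC.
Qed.

Section Multiplicity.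
Variables (F : finFieldType) (p : {poly F}).
Hypothesis p_irr : irreducible_poly p.

Lemma multiplicity_factor m g : ~~ (p %| g) -> multiplicity p (p ^+ m * g) = m.
Proof.
move=> pg; have p0 := irredp_neq0 p_irr.
have g0 : g != 0 by apply: contraNneq pg => ->; exact: dvdp0.
have sp : (1 < size p)%N by case: p_irr.
have dvd n : (p ^+ n %| p ^+ m * g) = (n <= m)%N.
  case: leqP => [nm|mn]; first by rewrite dvdp_mulr // dvdp_Pexp2l.
  apply: contraNF pg; rewrite -(subnKC (ltnW mn)) exprD dvdp_mul2l ?expf_neq0 //.
  by apply: dvdp_trans; rewrite -{1}[p]expr1 dvdp_Pexp2l // subn_gt0.
(* The maximum in [multiplicity] runs over exponents below the size of the polynomial, so [m] must
   be shown to lie in that range. *)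
have ms : (m < size (p ^+ m * g)%R)%N.
  rewrite size_mul ?expf_neq0 //; have := size_exp p m.
  have : (0 < size g)%N by rewrite size_poly_gt0.
  have : (0 < size (p ^+ m)%R)%N by rewrite size_poly_gt0 expf_neq0.
  have : (m <= (size p).-1 * m)%N by case: (size p) sp => [|[|s]] //= _; lia.
  by move: (_ * m)%N (size (polyseq (_ ^+ _))) (size g) => a b d; lia.
apply/eqP; rewrite eqn_leq; apply/andP; split.
  by apply/bigmax_leqP => i; rewrite dvd.
by rewrite /multiplicity; apply: (leq_bigmax_cond (Ordinal ms)); rewrite /= dvd.
Qed.

Lemma multiplicityP f : f != 0 ->
  exists2 g, f = p ^+ multiplicity p f * g & ~~ (p %| g).
Proof.
move=> f0; suff [m [g [fE pg]]] : exists m g, f = p ^+ m * g /\ ~~ (p %| g).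
  by exists g => //; rewrite {2}fE multiplicity_factor.
have p0 := irredp_neq0 p_irr; have sp : (1 < size p)%N by case: p_irr.
elim: {f}(size f) {-2}f (leqnn (size f)) f0 => [|n IH] f.
  by rewrite leqn0 size_poly_eq0 => ->.
move=> sf f0; have [/dvdpP[g fE]|pf] := boolP (p %| f); last first.
  by exists 0%N, f; rewrite mul1r.
have g0 : g != 0 by apply: contraNneq f0 => g0; rewrite fE g0 mul0r.
have sg : (size g <= n)%N.
  have := size_mul g0 p0; rewrite -fE; have : (0 < size g)%N by rewrite size_poly_gt0.
  by move: sp sf; move: (size f) (size g) (size p) => a b d; lia.
have [m [h [gE ph]]] := IH g sg g0.
by exists m.+1, h; split=> //; rewrite fE gE exprS mulrC mulrA.
Qed.

Lemma multiplicityM f g : f != 0 -> g != 0 ->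
  multiplicity p (f * g) = (multiplicity p f + multiplicity p g)%N.
Proof.
move=> /multiplicityP[f' fE pf] /multiplicityP[g' gE pg].
rewrite {1}fE {1}gE mulrACA -exprD multiplicity_factor //.
by rewrite -irreducible_poly_coprime // coprimepMr !irreducible_poly_coprime // pf.
Qed.

Lemma multiplicity_dvd f : f != 0 -> p ^+ multiplicity p f %| f.
Proof. by case/multiplicityP=> g fE _; rewrite {2}fE dvdp_mulr. Qed.

Lemma leq_multiplicity k f : f != 0 -> p ^+ k %| f -> (k <= multiplicity p f)%N.
Proof.
move=> f0 /dvdpP[g fE]; have p0 := irredp_neq0 p_irr.
have g0 : g != 0 by apply: contraNneq f0 => g0; rewrite fE g0 mul0r.
rewrite fE multiplicityM ?expf_neq0 // (_ : multiplicity p (p ^+ k) = k) ?leq_addl //.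
rewrite -[p ^+ k]mulr1 multiplicity_factor // dvdp1.
by have [sp _] := p_irr; rewrite neq_ltn sp orbT.
Qed.

Lemma multiplicity_gt0 f : f != 0 -> (0 < multiplicity p f)%N = (p %| f).
Proof.
move=> f0; apply/idP/idP => [|pf]; last by rewrite leq_multiplicity.
case: (multiplicity p f) (multiplicity_dvd f0) => // n dvd _.
by apply: dvdp_trans dvd; rewrite exprS dvdp_mulr.
Qed.

Local Notation frac := FracField.tofrac.

(** Independence of the representative: cross-multiplying two presentations gives an identity of
    polynomials, to which additivity of [multiplicity] applies. *)
Lemma ord_frac f g : f != 0 -> g != 0 ->
  ord (Some p) (frac f / frac g) = (multiplicity p f)%:Z - (multiplicity p g)%:Z.
Proof.
move=> f0 g0; set x := _ / _; rewrite /ord.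
have d0 := denom_ratioP (repr x).
have : frac \n_(repr x) * frac g = frac f * frac \d_(repr x).
  have /eqP := frac_numden x; rewrite eq_sym {3}/x => /eqP.
  by move/eqP; rewrite eqr_div ?tofrac_eq0 // => /eqP.
rewrite -!tofracM => /eqP; rewrite tofrac_eq => /eqP nE.
have n0 : \n_(repr x) != 0.
  apply: contraTneq (mulf_neq0 f0 d0) => n0.
  by rewrite negbK -nE n0 mul0r.
by have /(congr1 (multiplicity p)) := nE; rewrite !multiplicityM //; lia.
Qed.

Lemma ord_poly f : f != 0 -> ord (Some p) (frac f) = (multiplicity p f)%:Z.
Proof.
move=> f0; rewrite -[frac f]divr1 -tofrac1 ord_frac ?oner_eq0 //.
rewrite (_ : multiplicity p 1 = 0%N) ?subr0 //.
apply/eqP; rewrite -leqn0 leqNgt multiplicity_gt0 ?oner_eq0 // dvdp1.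
by have [sp _] := p_irr; rewrite neq_ltn sp orbT.
Qed.

Lemma multiplicity_eq0 f : f != 0 -> ~~ (p %| f) -> multiplicity p f = 0%N.
Proof. by move=> f0; rewrite -multiplicity_gt0 // -eqn0Ngt => /eqP. Qed.

Lemma frac_neq0P (x : {fraction {poly F}}) : x != 0 ->
  exists f g : {poly F}, [/\ f != 0, g != 0 & x = frac f / frac g].
Proof.
move=> x0; exists \n_(repr x), \d_(repr x); rewrite denom_ratioP -frac_numden.
split=> //; apply: contraNneq x0 => n0.
by rewrite [x]frac_numden n0 tofrac0 mul0r.
Qed.

(** The power of [p] in the denominator is cancelled against the numerator; a denominator prime to
    [p] is what later allows evaluation at a rational point. *)
Lemma ord_ge0P (x : {fraction {poly F}}) : x != 0 -> 0 <= ord (Some p) x ->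
  exists f g, ~~ (p %| g) /\ x = frac f / frac g.
Proof.
move=> /frac_neq0P[f [g [f0 g0 ->]]]; rewrite ord_frac // => fg.
have [f' fE pf] := multiplicityP f0; have [g' gE pg] := multiplicityP g0.
have p0 := irredp_neq0 p_irr.
exists (p ^+ (multiplicity p f - multiplicity p g) * f'), g'; split=> //.
have g'0 : g' != 0 by apply: contraNneq pg => ->; exact: dvdp0.
apply/eqP; rewrite eqr_div ?tofrac_eq0 // -!tofracM tofrac_eq {1}fE {2}gE.
by rewrite mulrACA -exprD subnK ?mulrA //; lia.
Qed.

Lemma ordM (x y : {fraction {poly F}}) : x != 0 -> y != 0 ->
  ord (Some p) (x * y) = ord (Some p) x + ord (Some p) y.
Proof.
move=> /frac_neq0P[f [g [f0 g0 ->]]] /frac_neq0P[f' [g' [f'0 g'0 ->]]].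
rewrite mulf_div -!tofracM !ord_frac ?mulf_neq0 // !multiplicityM //; lia.
Qed.

Lemma ordD n (x y : {fraction {poly F}}) :
  val_ge (ord (Some p)) n x -> val_ge (ord (Some p)) n y ->
  val_ge (ord (Some p)) n (x + y).
Proof.
have [->|x0] := eqVneq x 0; first by rewrite add0r.
have [->|y0] := eqVneq y 0; first by rewrite addr0.
have [xy0|xy0] := eqVneq (x + y) 0; first by left.
move=> [/eqP|nx]; first by rewrite (negbTE x0).
move=> [/eqP|ny]; first by rewrite (negbTE y0).
right; move: x0 y0 nx ny xy0.
move=> /frac_neq0P[f [g [f0 g0 ->]]] /frac_neq0P[f' [g' [f'0 g'0 ->]]].
move=> nf nf'; rewrite !ord_frac // in nf nf' *; rewrite addf_div ?tofrac_eq0 // -!tofracM -tofracD.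
have [->|s0] := eqVneq (f * g' + f' * g) 0; first by rewrite tofrac0 mul0r eqxx.
move=> _; rewrite (ord_frac s0 (mulf_neq0 g0 g'0)) (multiplicityM g0 g'0).
(* Over a common denominator the claim is a divisibility. The exponent involved may be negative, and
   then there is nothing to prove. *)
suff dvd k : k%:Z <= n + (multiplicity p g + multiplicity p g')%N%:Z ->
    p ^+ k %| f * g' + f' * g.
  have [z0|z0] := ltP (n + (multiplicity p g + multiplicity p g')%N%:Z) 0; first lia.
  have le : (absz (n + (multiplicity p g + multiplicity p g')%N%:Z)%R
      <= multiplicity p (f * g' + f' * g)%R)%N.
    by apply: leq_multiplicity => //; apply: dvd; rewrite gez0_abs.
  by lia.
have aux h h' : h != 0 -> h' != 0 -> (k <= multiplicity p h + multiplicity p h')%N ->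
    p ^+ k %| h * h'.
  move=> h0 h'0 kh; apply: dvdp_trans (multiplicity_dvd (mulf_neq0 h0 h'0)).
  by rewrite multiplicityM // dvdp_exp2l.
by move=> kn; apply: dvdp_add; apply: aux => //; lia.
Qed.

End Multiplicity.

(** * Valued fields and quaternion orders *)

(* [lia] does not identify the terms [v x] that differ by canonical instances,
   hence the abstraction up to unification first. *)
Local Ltac vlia := intros; match goal with v : _ -> int |- _ =>
  repeat match goal with H : context [v _] |- _ => revert H end;
  repeat match goal with |- context [v ?x] => move: (v x) => ? end
  end; intros; lia.

Section Valuation.
Variables (L : fieldType) (val : L -> int).

(** [val 0] carries no information, so the ultrametric inequality is phrased with [val_ge], which
    holds at 0 for every bound. *)
Record is_valuation : Prop := IsValuation {
  val_mul : forall x y, x != 0 -> y != 0 -> val (x * y) = val x + val y;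
  val_add : forall n x y,
    val_ge val n x -> val_ge val n y -> val_ge val n (x + y) }.

Hypothesis val_v : is_valuation.

Lemma val_one : val 1 = 0.
Proof. by have := val_mul val_v (oner_neq0 _) (oner_neq0 _); rewrite mulr1; vlia. Qed.

Lemma val_inv x : x != 0 -> val x^-1 = - val x.
Proof.
move=> x0; have := val_mul val_v x0 (invr_neq0 x0).
by rewrite divff // val_one; vlia.
Qed.

Lemma val_opp x : x != 0 -> val (- x) = val x.
Proof.
move=> x0; have N10 : -1 != 0 :> L by rewrite oppr_eq0 oner_neq0.
have := val_mul val_v N10 N10; rewrite mulrNN mulr1 val_one => v1.
by rewrite -mulN1r val_mul //; vlia.
Qed.

Lemma val_exp x n : x != 0 -> val (x ^+ n) = val x *+ n.
Proof.
move=> x0; elim: n => [|n IH]; first by rewrite expr0 val_one.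
by rewrite exprS val_mul ?expf_neq0 // IH mulrS.
Qed.

Lemma val_expz x (n : int) : x != 0 -> val (x ^ n) = val x * n.
Proof.
move=> x0; case: n => n; first by rewrite -exprnP val_exp //; vlia.
by rewrite -[x ^ _]/(x ^- n.+1) val_inv ?expf_neq0 // val_exp //; vlia.
Qed.

Lemma vge0 n : val_ge val n 0. Proof. by left. Qed.

Lemma vgeE n x : x != 0 -> val_ge val n x <-> n <= val x.
Proof. by move=> x0; split=> [[/eqP|//]|]; [rewrite (negbTE x0)|right]. Qed.

Lemma vge_le m n x : n <= m -> val_ge val m x -> val_ge val n x.
Proof. by move=> nm [->|mx]; [left|right; vlia]. Qed.

Lemma vgeN n x : val_ge val n x -> val_ge val n (- x).
Proof.
have [->|x0] := eqVneq x 0; first by rewrite oppr0.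
by rewrite !vgeE ?oppr_eq0 // val_opp.
Qed.

Lemma vgeB n x y : val_ge val n x -> val_ge val n y -> val_ge val n (x - y).
Proof. by move=> nx ny; apply: val_add => //; exact: vgeN. Qed.

Lemma vgeM m n x y : val_ge val m x -> val_ge val n y -> val_ge val (m + n) (x * y).
Proof.
have [->|x0] := eqVneq x 0; first by rewrite mul0r; left.
have [->|y0] := eqVneq y 0; first by rewrite mulr0; left.
by rewrite !vgeE ?mulf_neq0 // val_mul //; vlia.
Qed.

Lemma vge_mulr n x y : val_ge val 0 x -> val_ge val n y -> val_ge val n (x * y).
Proof. by move=> x0 ny; rewrite -[n]add0r; exact: vgeM. Qed.

Lemma vge1 : val_ge val 0 1.
Proof. by right; rewrite val_one. Qed.

Lemma vge_nat n : val_ge val 0 n%:R.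
Proof.
by elim: n => [|n IH]; [left|rewrite -natr1; apply: val_add => //; exact: vge1].
Qed.

Lemma vgeV n x : x != 0 -> val x <= n -> val_ge val (- n) x^-1.
Proof. by move=> x0 xn; right; rewrite val_inv //; vlia. Qed.

(** If the two values differed, the element of smaller value would be a combination of two elements
    of strictly larger value. *)
Lemma val_congr x y n : y != 0 -> val y < n -> val_ge val n (x - y) ->
  x != 0 /\ val x = val y.
Proof.
move=> y0 yn xy; have x0 : x != 0.
  apply/eqP => x_0; move: xy; rewrite x_0 sub0r vgeE ?oppr_eq0 // val_opp //; vlia.
split=> //.
have [vx|vx|//] := ltgtP (val x) (val y).
  have : val_ge val (val x + 1) x.
    rewrite -{2}(subrK y x); apply: val_add => //; first by apply: vge_le xy; vlia.
    by right; vlia.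
  by rewrite vgeE //; vlia.
have : val_ge val (val y + 1) y.
  rewrite -{2}(subKr x y); apply: vgeB; first by right; vlia.
  by apply: vge_le xy; vlia.
by rewrite vgeE //; vlia.
Qed.

Lemma val_congr_one x : val_ge val 1 (x - 1) -> x != 0 /\ val x = 0.
Proof.
move=> /(val_congr (oner_neq0 _)); rewrite val_one; exact.
Qed.

End Valuation.

(** The norm form of [R[Z]]: the norm of [a + bZ] when [Z^2 = eZ + c]. *)
Definition norm2 (R : comNzRingType) (e c a b : R) := a * a + e * (a * b) - c * (b * b).

Section Norm.
Variables (R : comNzRingType) (e c t : R).
Local Notation Q := (quat e c t).

(** The reduced norm, [N alpha - t N beta] on [alpha + F beta]. *)
Definition nrd (x : Q) :=
  norm2 e c (coef1 x) (coefZ x) - t * norm2 e c (coefF x) (coefFZ x).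

Lemma mul_quat_conj (x : Q) : x * quat_conj x = (nrd x)%:A.
Proof. by case: x => ????; rewrite /nrd /norm2; congr Quat => /=; ring. Qed.

Lemma mul_conj_quat (x : Q) : quat_conj x * x = (nrd x)%:A.
Proof. by case: x => ????; rewrite /nrd /norm2; congr Quat => /=; ring. Qed.

Lemma nrdM (x y : Q) : nrd (x * y) = nrd x * nrd y.
Proof. by case: x y => ????[????]; rewrite /nrd /norm2 /=; ring. Qed.

Lemma nrdZ k (x : Q) : nrd (k *: x) = k ^+ 2 * nrd x.
Proof. by case: x => ????; rewrite /nrd /norm2 /=; ring. Qed.

Lemma nrd_conj (x : Q) : nrd (quat_conj x) = nrd x.
Proof. by case: x => ????; rewrite /nrd /norm2 /=; ring. Qed.

Lemma nrd1 : nrd 1 = 1.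
Proof. by rewrite /nrd /norm2 /=; ring. Qed.

Lemma quat_conjK : involutive (@quat_conj R e c t).
Proof. by case=> ????; congr Quat => /=; ring. Qed.

Lemma quatP (x y : Q) : coef1 x = coef1 y -> coefZ x = coefZ y ->
  coefF x = coefF y -> coefFZ x = coefFZ y -> x = y.
Proof. by case: x y => ????[????] /= -> -> -> ->. Qed.

Lemma quat_conj0 : quat_conj (0 : Q) = 0.
Proof. by congr Quat => /=; ring. Qed.

End Norm.

Section QuatMap.
Variables (R R' : comNzRingType) (f : {rmorphism R -> R'}) (e c t : R).
Local Notation Q := (quat e c t).

Lemma quat_mapM (x y : Q) : quat_map f (x * y) = quat_map f x * quat_map f y.
Proof.
by case: x y => ????[????]; congr Quat => /=; rewrite !(rmorphD, rmorphN, rmorphM).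
Qed.

Lemma quat_mapZ k (x : Q) : quat_map f (k *: x) = f k *: quat_map f x.
Proof. by case: x => ????; congr Quat => /=; rewrite rmorphM. Qed.

Lemma quat_map1 : quat_map f (1 : Q) = 1.
Proof. by congr Quat => /=; rewrite ?rmorph0 ?rmorph1. Qed.

Lemma nrd_map (x : Q) : nrd (quat_map f x) = f (nrd x).
Proof. by case: x => ????; rewrite /nrd /norm2 /= !(rmorphD, rmorphN, rmorphM). Qed.

End QuatMap.

Section QuatInv.
Variables (L : fieldType) (e c t : L).
Local Notation Q := (quat e c t).

Definition quat_inv (x : Q) : Q := (nrd x)^-1 *: quat_conj x.

Lemma mul_quat_inv x : nrd x != 0 -> x * quat_inv x = 1.
Proof.
by move=> x0; rewrite -scalerAr mul_quat_conj scalerA mulVf // scale1r.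
Qed.

Lemma mul_inv_quat x : nrd x != 0 -> quat_inv x * x = 1.
Proof.
by move=> x0; rewrite -scalerAl mul_conj_quat scalerA mulVf // scale1r.
Qed.

Lemma nrdM_neq0 (x y : Q) : nrd x != 0 -> nrd y != 0 -> nrd (x * y) != 0.
Proof. by move=> x0 y0; rewrite nrdM mulf_neq0. Qed.

Lemma nrdZ_neq0 k (x : Q) : k != 0 -> nrd x != 0 -> nrd (k *: x) != 0.
Proof. by move=> k0 x0; rewrite nrdZ mulf_neq0 ?expf_neq0. Qed.

Lemma nrd_inv_neq0 (x : Q) : nrd x != 0 -> nrd (quat_inv x) != 0.
Proof. by move=> x0; rewrite nrdZ_neq0 ?nrd_conj ?invr_eq0. Qed.

Lemma nrd_inv x : nrd x != 0 -> nrd (quat_inv x) = (nrd x)^-1.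
Proof. by move=> x0; rewrite nrdZ nrd_conj; field. Qed.

(** Multiplicativity of the reduced norm makes a one-sided inverse two-sided. The identities for
    [quat_inv] below are read off from this uniqueness. *)
Lemma quat_mul1_inv (x y : Q) : x * y = 1 -> nrd x != 0 /\ y = quat_inv x.
Proof.
move=> xy; have x0 : nrd x != 0.
  apply: contra_eq_neq (nrd1 e c t) => x0.
  by rewrite -xy nrdM x0 mul0r eq_sym oner_neq0.
by split=> //; rewrite -[RHS]mulr1 -xy mulrA mul_inv_quat // mul1r.
Qed.

Lemma quat_inv_scale k x : k != 0 -> nrd x != 0 ->
  quat_inv (k *: x) = k^-1 *: quat_inv x.
Proof.
move=> k0 x0; have kx : nrd (k *: x) != 0 by rewrite nrdZ mulf_neq0 ?expf_neq0.
symmetry; apply: (proj2 (quat_mul1_inv _)).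
by rewrite -scalerAl -scalerAr scalerA divff // scale1r mul_quat_inv.
Qed.

Lemma quat_invM x y : nrd x != 0 -> nrd y != 0 ->
  quat_inv (x * y) = quat_inv y * quat_inv x.
Proof.
move=> x0 y0; symmetry; apply: (proj2 (quat_mul1_inv _)).
by rewrite mulrA -(mulrA x) mul_quat_inv // mulr1 mul_quat_inv.
Qed.

Lemma quat_invK x : nrd x != 0 -> quat_inv (quat_inv x) = x.
Proof.
by move=> x0; symmetry; apply: (proj2 (quat_mul1_inv _)); rewrite mul_inv_quat.
Qed.

Lemma quat_inv1 : quat_inv (1 : Q) = 1.
Proof. by symmetry; apply: (proj2 (quat_mul1_inv _)); rewrite mulr1. Qed.

End QuatInv.

Section QuatVal.
Variables (L : fieldType) (val : L -> int).
Hypothesis val_v : is_valuation val.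
Variables (e c t : L).
Local Notation Q := (quat e c t).

(** For [n = 0], membership in the order spanned by 1, Z, F and FZ over the valuation ring; for
    general [n], in its multiples by elements of value [n]. *)
Definition qge n (x : Q) := [/\ val_ge val n (coef1 x), val_ge val n (coefZ x),
  val_ge val n (coefF x) & val_ge val n (coefFZ x)].

Lemma qgeD n x y : qge n x -> qge n y -> qge n (x + y).
Proof. by move=> [????] [????]; split; apply: (val_add val_v). Qed.

Lemma qgeN n x : qge n x -> qge n (- x).
Proof. by move=> [????]; split; apply: (vgeN val_v). Qed.

Lemma qgeB n x y : qge n x -> qge n y -> qge n (x - y).
Proof. by move=> nx ny; apply: qgeD => //; exact: qgeN. Qed.

Lemma qge_pair n a b : val_ge val n a -> val_ge val n b -> qge n (Quat e c t a b 0 0).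
Proof. by move=> ? ?; split=> //; left. Qed.

Lemma qgeZ m n k x : val_ge val m k -> qge n x -> qge (m + n) (k *: x).
Proof. by move=> ? [????]; split; apply: (vgeM val_v). Qed.

Hypotheses (he : val_ge val 0 e) (hc : val_ge val 0 c) (ht : val_ge val 0 t).

Lemma qge_conj n x : qge n x -> qge n (quat_conj x).
Proof.
move=> [????]; split=> /=; try exact: (vgeN val_v).
by apply: (val_add val_v) => //; exact: (vge_mulr val_v).
Qed.

Lemma qgeM m n x y : qge m x -> qge n y -> qge (m + n) (x * y).
Proof.
case: x y => a0 a1 a2 a3 [b0 b1 b2 b3] [/= ????] [/= ????].
by split=> /=;
  rewrite ?mulrDl -?mulrA;
  repeat first [ exact: (vgeM val_v) | apply: (vgeB val_v) | apply: (val_add val_v)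
    | apply: (vge_mulr val_v); [by [] |] ].
Qed.

Lemma qgeM0 x y : qge 0 x -> qge 0 y -> qge 0 (x * y).
Proof. by move=> ix iy; rewrite -[0]addr0; exact: qgeM. Qed.

Lemma norm2_ge n a b : val_ge val n a -> val_ge val n b ->
  val_ge val (n + n) (norm2 e c a b).
Proof.
move=> na nb; apply: (vgeB val_v); first apply: (val_add val_v).
- exact: (vgeM val_v).
- by apply: (vge_mulr val_v) => //; exact: (vgeM val_v).
- by apply: (vge_mulr val_v) => //; exact: (vgeM val_v).
Qed.

Lemma nrd_ge n x : qge n x -> val_ge val (n + n) (nrd x).
Proof.
move=> [????]; apply: (vgeB val_v); first exact: norm2_ge.
by apply: (vge_mulr val_v) => //; exact: norm2_ge.
Qed.

(** The descent step: as the inverse of [x] is [conj x / nrd x], left divisibility of [y] by [x] is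
    a congruence for [conj x * y], and the division lowers the valuation of the norm. *)
Lemma quat_inv_mul_ge (x y : Q) : nrd x != 0 -> nrd y != 0 ->
  qge (val (nrd x)) (quat_conj x * y) ->
  qge 0 (quat_inv x * y) /\ val (nrd (quat_inv x * y)) = val (nrd y) - val (nrd x).
Proof.
move=> x0 y0 xy; split.
  rewrite -scalerAl -(addNr (val (nrd x))); apply: qgeZ => //.
  exact: (vgeV val_v).
by rewrite nrdM nrd_inv // (val_mul val_v) ?invr_eq0 // (val_inv val_v) // addrC.
Qed.

Lemma qge_quat_inv (x : Q) : nrd x != 0 -> val (nrd x) = 0 -> qge 0 x -> qge 0 (quat_inv x).
Proof.
move=> x0 vx ix; rewrite -[0]addr0; apply: qgeZ; last exact: qge_conj.
by rewrite -oppr0; apply: (vgeV val_v) => //; rewrite vx.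
Qed.

Lemma exists_integral_multiple p (x : Q) : p != 0 -> val p = 1 ->
  exists2 k, k != 0 & qge 0 (k *: x).
Proof.
move=> p0 vp.
have aux y : exists N, forall n, (N <= n)%N -> val_ge val 0 (p ^+ n * y).
  have [->|y0] := eqVneq y 0; first by exists 0%N => n _; rewrite mulr0; left.
  exists `|val y|%N => n Nn; right.
  by rewrite (val_mul val_v) ?expf_neq0 // (val_exp val_v) // vp; move: (val y) Nn => z; lia.
have [N0 h0] := aux (coef1 x); have [N1 h1] := aux (coefZ x).
have [N2 h2] := aux (coefF x); have [N3 h3] := aux (coefFZ x).
exists (p ^+ (N0 + N1 + N2 + N3)); first by rewrite expf_neq0.
by split; [apply: h0|apply: h1|apply: h2|apply: h3]; lia.
Qed.

Lemma qge1 : qge 0 1.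
Proof. by split=> /=; [exact: (vge1 val_v)|left|left|left]. Qed.

End QuatVal.

Lemma quat_map_inv (L L' : fieldType) (f : {rmorphism L -> L'}) (e c t : L)
  (x : quat e c t) : nrd x != 0 -> quat_map f (quat_inv x) = quat_inv (quat_map f x).
Proof.
move=> x0; apply: (proj2 (quat_mul1_inv _)).
by rewrite -quat_mapM mul_quat_inv // quat_map1.
Qed.

(** * The maximal order at a place of good reduction *)

Section UnramifiedPlace.
(** [iota] embeds the field of constants [k], which represents all residues, and [t] reduces to the
    nonzero constant [tau]. By [aniso] and [disc_neq0], [k[Z]] is a separable quadratic field
    extension of [k]. *)
Variables (k L : fieldType) (val : L -> int) (iota : {rmorphism k -> L}).
Variables (e0 c0 tau : k) (e c t : L).
Hypothesis val_v : is_valuation val.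
Hypothesis aniso : forall a b, norm2 e0 c0 a b = 0 -> a = 0 /\ b = 0.
Hypothesis disc_neq0 : e0 * e0 + 4%:R * c0 != 0.
Hypothesis tau_neq0 : tau != 0.
Hypothesis val_iota : forall a, a != 0 -> val (iota a) = 0.
Hypothesis residue : forall x, val_ge val 0 x -> exists a, val_ge val 1 (x - iota a).
Hypotheses (eE : e = iota e0) (cE : c = iota c0).
Hypotheses (pi_neq0 : t - iota tau != 0) (val_pi : val (t - iota tau) = 1).

Local Notation Q := (quat e c t).
Local Notation integral := (val_ge val 0).
Local Notation small := (val_ge val 1).
Local Notation pi := (t - iota tau).

Lemma iota_integral a : integral (iota a).
Proof.
have [->|a0] := eqVneq a 0; first by rewrite rmorph0; left.
by right; rewrite val_iota.
Qed.

Lemma e_integral : integral e. Proof. by rewrite eE; exact: iota_integral. Qed.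
Lemma c_integral : integral c. Proof. by rewrite cE; exact: iota_integral. Qed.

Lemma pi_small : small pi.
Proof. by right; rewrite val_pi. Qed.

Lemma t_unit : t != 0 /\ val t = 0.
Proof.
have t1 : iota tau != 0 by rewrite fmorph_eq0.
by have := val_congr val_v t1 _ pi_small; rewrite val_iota //; apply.
Qed.

Lemma t_integral : integral t.
Proof. by right; rewrite (proj2 t_unit). Qed.

Lemma iota_norm2 a b : iota (norm2 e0 c0 a b) = norm2 e c (iota a) (iota b).
Proof. by rewrite /norm2 eE cE !(rmorphB, rmorphD, rmorphM). Qed.

Lemma small_iota a : small (iota a) -> a = 0.
Proof.
move=> sa; apply/eqP; apply: contraPT sa => a0.
by rewrite vgeE ?fmorph_eq0 // val_iota.
Qed.

Lemma norm2_congr a b A B : integral a -> integral b ->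
  small (a - iota A) -> small (b - iota B) ->
  small (norm2 e c a b - iota (norm2 e0 c0 A B)).
Proof.
move=> ia ib aA bB; rewrite iota_norm2.
have -> : norm2 e c a b - norm2 e c (iota A) (iota B) =
    (a + iota A) * (a - iota A) + e * (b * (a - iota A)) + e * (iota A * (b - iota B))
    - c * ((b + iota B) * (b - iota B)) by rewrite /norm2; ring.
have iA := iota_integral A; have iB := iota_integral B.
have ie := e_integral; have ic := c_integral.
apply: (vgeB val_v); first apply: (val_add val_v); first apply: (val_add val_v).
- by apply: (vge_mulr val_v) => //; exact: (val_add val_v).
- by do 2!apply: (vge_mulr val_v) => //.
- by do 2!apply: (vge_mulr val_v) => //.
- by do 2!apply: (vge_mulr val_v) => //; exact: (val_add val_v).
Qed.

(** Anisotropy over the residue field: the norm reduces to the norm of the residues, which vanishes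
    only if both residues do. *)
Lemma norm2_unit a b : integral a -> integral b -> ~ (small a /\ small b) ->
  norm2 e c a b != 0 /\ val (norm2 e c a b) = 0.
Proof.
move=> ia ib nab; have [A aA] := residue ia; have [B bB] := residue ib.
have N0 : norm2 e0 c0 A B != 0.
  apply/eqP => /aniso[A0 B0]; apply: nab.
  by move: aA bB; rewrite A0 B0 rmorph0 !subr0.
have iN0 : iota (norm2 e0 c0 A B) != 0 by rewrite fmorph_eq0.
have := val_congr (n := 1) val_v iN0; rewrite val_iota //; apply=> //.
exact: norm2_congr.
Qed.

(** [L[Z]] is unramified over [L], so norms have even valuation: scaling by a power of the
    uniformiser makes one coordinate a unit, and then the norm is a unit. *)
Lemma norm2_val a b : a != 0 \/ b != 0 ->
  exists m, [/\ val_ge val m a, val_ge val m b, norm2 e c a b != 0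
              & val (norm2 e c a b) = m + m].
Proof.
move=> ab.
(* [m] is the smaller of the two valuations, a zero coordinate counting as infinite. *)
have [m [ma mb mab]] : exists m, [/\ val_ge val m a, val_ge val m b &
    ~ (val_ge val (m + 1) a /\ val_ge val (m + 1) b)].
  have [a0|a0] := eqVneq a 0.
    have b0 : b != 0 by case: ab => //; rewrite a0 eqxx.
    exists (val b); split; [by left|by right|].
    by rewrite (vgeE _ _ b0) => -[_]; lia.
  have [b0|b0] := eqVneq b 0.
    exists (val a); split; [by right|by left|].
    by rewrite (vgeE _ _ a0) => -[+ _]; lia.
  have [ab_le|ba_lt] := leP (val a) (val b).
    exists (val a); split; [by right|by right|].
    by rewrite (vgeE _ _ a0) => -[+ _]; lia.
  exists (val b); split; [by right; lia|by right|].
  by rewrite (vgeE _ _ b0) => -[_]; lia.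
exists m; have pm n : pi ^ n != 0 by rewrite expfz_neq0.
have vp n : val (pi ^ n) = n by rewrite val_expz // val_pi mul1r.
have vgep n : val_ge val n (pi ^ n) by right; rewrite vp.
pose a' := pi ^ (- m) * a; pose b' := pi ^ (- m) * b.
have aE : a = pi ^ m * a' by rewrite /a' mulrA -expfzDr // subrr expr0z mul1r.
have bE : b = pi ^ m * b' by rewrite /b' mulrA -expfzDr // subrr expr0z mul1r.
have ia : integral a' by rewrite -(addNr m); exact: (vgeM val_v).
have ib : integral b' by rewrite -(addNr m); exact: (vgeM val_v).
have [|N0 vN] := norm2_unit ia ib.
  by move=> [sa sb]; apply: mab; rewrite aE bE; split; exact: (vgeM val_v).
have -> : norm2 e c a b = pi ^ m * pi ^ m * norm2 e c a' b'.
  by rewrite {1}aE {1}bE /norm2; ring.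
by split; rewrite ?mulf_neq0 // !(val_mul val_v) ?mulf_neq0 // vN !vp addr0.
Qed.

Lemma norm2_eq0 a b : norm2 e c a b = 0 -> a = 0 /\ b = 0.
Proof.
move=> N0; apply: contrapT => /not_andP ab.
have [|m [_ _]] := @norm2_val a b; last by rewrite N0 eqxx.
by case: ab => /eqP; [left|right].
Qed.

Lemma norm2_integral a b : integral (norm2 e c a b) -> integral a /\ integral b.
Proof.
have [-> |a0] := eqVneq a 0; last first.
  have [m [ma mb N0 vN]] := @norm2_val a b (or_introl a0).
  by rewrite vgeE // vN => m0; split; [apply: vge_le ma|apply: vge_le mb]; lia.
have [-> |b0] := eqVneq b 0; first by split; left.
have [m [ma mb N0 vN]] := @norm2_val 0 b (or_intror b0).
by rewrite vgeE // vN => m0; split; [apply: vge_le ma|apply: vge_le mb]; lia.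
Qed.

(** For [w = alpha + F beta] of norm 0 one has [N alpha = t N beta], and [N beta] is nonzero because
    [w] is; so [alpha / beta] has norm [t]. *)
Lemma isotropic_norm (w : Q) : w != 0 -> nrd w = 0 ->
  exists u0 u1, norm2 e c u0 u1 = t.
Proof.
case: w => a0 a1 a2 a3 w0 /eqP; rewrite /nrd /= subr_eq0 => /eqP Nw.
have N0 : norm2 e c a2 a3 != 0.
  apply: contraNneq w0 => /[dup] /norm2_eq0[a20 a30] N0.
  by move: Nw; rewrite N0 mulr0 => /norm2_eq0[-> ->]; rewrite a20 a30.
pose b0 := a2 + e * a3; pose N := norm2 e c a2 a3.
(* The coordinates of [alpha conj(beta) / N beta], where [conj(beta) = b0 - a3 Z]. *)
exists ((a0 * b0 - c * (a1 * a3)) / N), ((a1 * b0 - a0 * a3 - e * (a1 * a3)) / N).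
have -> x y : norm2 e c (x / N) (y / N) = norm2 e c x y / (N * N).
  by rewrite invfM /norm2; ring.
have -> : norm2 e c (a0 * b0 - c * (a1 * a3)) (a1 * b0 - a0 * a3 - e * (a1 * a3))
    = norm2 e c a0 a1 * N by rewrite /N /b0 /norm2; ring.
by rewrite Nw -/N -(mulrA t) mulfK ?mulf_neq0.
Qed.

(* If [w = alpha + F beta] reduces to a nonzero element of norm 0 modulo the
   place, then [conj (1 + F b)] kills the reduction for [b = beta / alpha]. *)
Lemma neighbour_step (w : Q) : qge val 0 w -> small (nrd w) ->
  qge val 1 w \/ exists b0 b1, norm2 e0 c0 b0 b1 = tau^-1 /\
    qge val 1 (quat_conj (Quat e c t 1 0 (iota b0) (iota b1)) * w).
Proof.
case: w => a0 a1 a2 a3 [/= i0 i1 i2 i3] sN.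
have [A0 aA0] := residue i0; have [A1 aA1] := residue i1.
have [A2 aA2] := residue i2; have [A3 aA3] := residue i3.
pose n01 := norm2 e0 c0 A0 A1; pose n23 := norm2 e0 c0 A2 A3.
(* The difference of the two sides is a constant congruent to the norm of the element, hence small,
   hence 0. *)
have NE : n01 = tau * n23.
  apply/eqP; rewrite -subr_eq0; apply/eqP/small_iota.
  have -> : iota (n01 - tau * n23) = nrd (Quat e c t a0 a1 a2 a3)
      - (norm2 e c a0 a1 - iota n01) + t * (norm2 e c a2 a3 - iota n23)
      + iota n23 * pi.
    by rewrite /nrd /= rmorphB rmorphM; ring.
  apply: (val_add val_v); last by apply: (vge_mulr val_v); [exact: iota_integral|exact: pi_small].
  apply: (val_add val_v); last first.
    by apply: (vge_mulr val_v); [exact: t_integral|exact: norm2_congr].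
  by apply: (vgeB val_v) => //; exact: norm2_congr.
have [n23_0|n23_0] := eqVneq n23 0.
  left; move: NE; rewrite n23_0 mulr0 => /aniso[A00 A10].
  have [A20 A30] := aniso n23_0; move: aA0 aA1 aA2 aA3.
  by rewrite A00 A10 A20 A30 rmorph0 !subr0; split.
right; have n01_0 : n01 != 0 by rewrite NE mulf_neq0.
(* [b0 + b1 Z] is [beta / alpha] in [k[Z]], computed as [beta conj(alpha) / N alpha] on residues. *)
pose b0 := (A2 * (A0 + e0 * A1) - c0 * (A3 * A1)) / n01.
pose b1 := (A3 * A0 - A2 * A1) / n01.
(* The next four identities say [b alpha = beta] and [conj(b) beta = alpha / tau] in coordinates;
   the second follows from the first and [N b = 1 / tau]. *)
have b0E : b0 * A0 + c0 * (b1 * A1) = A2.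
  by rewrite /b0 /b1; move: n01_0; rewrite /n01 /norm2 => ?; field.
have b1E : b0 * A1 + b1 * A0 + e0 * (b1 * A1) = A3.
  by rewrite /b0 /b1; move: n01_0; rewrite /n01 /norm2 => ?; field.
have tn0 : tau * n23 != 0 by rewrite -NE.
have c0E : (b0 + e0 * b1) * A2 - c0 * (b1 * A3) = A0 / tau.
  rewrite /b0 /b1 NE; move: tn0 n23_0; rewrite /n23 /norm2 => ? ?; field.
  by rewrite tau_neq0.
have c1E : b0 * A3 - b1 * A2 = A1 / tau.
  rewrite /b0 /b1 NE; move: tn0 n23_0; rewrite /n23 /norm2 => ? ?; field.
  by rewrite tau_neq0.
have bE : norm2 e0 c0 b0 b1 = n23 / n01.
  by rewrite /b0 /b1; move: n01_0; rewrite /n23 /n01 /norm2 => ?; field.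
clearbody b0 b1; exists b0, b1; split.
  by rewrite bE NE invfM mulrCA divff ?mulr1.
set s := quat_conj _; pose C := Quat e c t (iota A0) (iota A1) (iota A2) (iota A3).
have -> : Quat e c t a0 a1 a2 a3 = C + (Quat e c t a0 a1 a2 a3 - C) by rewrite addrC subrK.
rewrite mulrDr; apply: (qgeD val_v).
  (* On the lift by constants, [(1 - F b)(alpha + F beta) = alpha - t conj(b) beta + F (beta - b
     alpha)], which equals [- (t - tau) alpha / tau]. *)
  have -> : s * C = Quat e c t (- pi * iota (A0 / tau)) (- pi * iota (A1 / tau)) 0 0.
    have A0E : iota A0 = iota tau * iota (A0 / tau) by rewrite -rmorphM mulrC divfK.
    have A1E : iota A1 = iota tau * iota (A1 / tau) by rewrite -rmorphM mulrC divfK.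
    have c0I : (iota b0 + e * iota b1) * iota A2 - c * (iota b1 * iota A3) = iota (A0 / tau).
      by rewrite -c0E !(rmorphD, rmorphN, rmorphM) -eE -cE.
    have c1I : iota b0 * iota A3 - iota b1 * iota A2 = iota (A1 / tau).
      by rewrite -c1E !(rmorphD, rmorphN, rmorphM).
    have b0I : iota b0 * iota A0 + c * (iota b1 * iota A1) = iota A2.
      by rewrite -b0E !(rmorphD, rmorphM) -cE.
    have b1I : iota b0 * iota A1 + iota b1 * iota A0 + e * (iota b1 * iota A1) = iota A3.
      by rewrite -b1E !(rmorphD, rmorphM) -eE.
    apply: quatP; rewrite /s /C /=.
    - by rewrite A0E -c0I; ring.
    - by rewrite A1E -c1I; ring.
    - by rewrite -b0I; ring.
    - by rewrite -b1I; ring.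
  by apply: qge_pair; rewrite mulrC; apply: (vge_mulr val_v);
    [exact: iota_integral|exact: (vgeN val_v pi_small)
    |exact: iota_integral|exact: (vgeN val_v pi_small)].
rewrite -[1]add0r; apply: (qgeM val_v e_integral c_integral t_integral); last by split.
split=> /=.
- by rewrite mulr0 addr0; exact: vge1.
- by rewrite oppr0; left.
- exact: (vgeN val_v (iota_integral _)).
- exact: (vgeN val_v (iota_integral _)).
Qed.

(** * The lattice attached to a splitting of the quaternion algebra *)

Section Splitting.
Variable phi : {lrmorphism Q -> 'M[L]_2}.
Hypothesis phi_bij : bijective phi.
Variables u0 u1 : L.
Hypothesis norm_u : norm2 e c u0 u1 = t.
Local Notation ZQ := (genZ e c t).
Local Notation FQ := (genF e c t).

(* Modulo the left ideal generated by [F + u], the quaternion [w] is congruent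
   to [red w], which lies in [L[Z]]. *)
Definition red (w : Q) : Q := Quat e c t (coef1 w) (coefZ w) 0 0 -
  Quat e c t (coefF w + e * coefFZ w) (- coefFZ w) 0 0 * Quat e c t u0 u1 0 0.

Lemma sub_red (w : Q) : w - red w =
  Quat e c t (coefF w + e * coefFZ w) (- coefFZ w) 0 0 * Quat e c t u0 u1 1 0.
Proof. by case: w => ????; congr Quat => /=; ring. Qed.

Lemma coefF_red w : coefF (red w) = 0. Proof. by rewrite /red /=; ring. Qed.
Lemma coefFZ_red w : coefFZ (red w) = 0. Proof. by rewrite /red /=; ring. Qed.

Lemma red_split w : red w = (coef1 (red w))%:A + coefZ (red w) *: ZQ.
Proof. by apply: quatP; rewrite ?coefF_red ?coefFZ_red /=; ring. Qed.

Lemma u_integral : integral u0 /\ integral u1.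
Proof. by apply: norm2_integral; rewrite norm_u; exact: t_integral. Qed.

Local Notation U := (Quat e c t u0 u1 0 0).
Local Notation conjF w := (Quat e c t (coefF w + e * coefFZ w) (- coefFZ w) 0 0).

Lemma qge_red w : qge val 0 w -> qge val 0 (red w).
Proof.
have [iu0 iu1] := u_integral; move=> [a0 a1 a2 a3].
apply: (qgeB val_v); first exact: qge_pair.
rewrite -[0]addr0; apply: (qgeM val_v e_integral c_integral t_integral); apply: qge_pair => //.
  by apply: (val_add val_v) => //; exact: (vge_mulr val_v e_integral).
exact: (vgeN val_v).
Qed.

(** With [w = alpha + F beta], [red w] is [alpha - conj(beta) u] and [red (w Z)] is
    [alpha Z - conj(Z) conj(beta) u]. This linear system for [alpha] and [conj(beta)] is solvable
    integrally because the discriminant and [t] are units. *)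
Lemma red_qge w : qge val 0 (red w) -> qge val 0 (red (w * ZQ)) -> qge val 0 w.
Proof.
have [iu0 iu1] := u_integral; move=> ir irZ.
have iM (x y : Q) : qge val 0 x -> qge val 0 y -> qge val 0 (x * y).
  move=> ? ?; rewrite -[0]addr0.
  exact: (qgeM val_v e_integral c_integral t_integral).
have i0 : integral 0 by left.
have i1 := vge1 val_v.
have idisc : integral (iota (e0 * e0 + 4%:R * c0))^-1.
  by rewrite -fmorphV; exact: iota_integral.
have discE : iota (e0 * e0 + 4%:R * c0) = e * e + 4%:R * c.
  by rewrite eE cE rmorphD !rmorphM rmorph_nat.
(* [red (w Z) - conj(Z) red w = (2Z - e) alpha], and [(2Z - e)^2] is the discriminant [e^2 + 4c]. *)
have alphaE : Quat e c t (coef1 w) (coefZ w) 0 0 = (iota (e0 * e0 + 4%:R * c0))^-1 *: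
    (Quat e c t (- e) 2%:R 0 0 * (red (w * ZQ) - Quat e c t e (-1) 0 0 * red w)).
  apply: (@scalerI _ _ (iota (e0 * e0 + 4%:R * c0))); first by rewrite fmorph_eq0.
  rewrite scalerA divff ?fmorph_eq0 // scale1r discE.
  by case: w {ir irZ} => ????; congr Quat => /=; ring.
have ialpha : qge val 0 (Quat e c t (coef1 w) (coefZ w) 0 0).
  rewrite alphaE -[0]addr0; apply: (qgeZ val_v) => //; apply: (iM _ _).
    by apply: qge_pair; [exact: (vgeN val_v e_integral)|exact: vge_nat].
  apply: (qgeB val_v) => //; apply: (iM _ _) => //; apply: qge_pair; first exact: e_integral.
  exact: (vgeN val_v).
have [t0 vt] := t_unit.
(* [alpha - red w = conj(beta) u], and [u conj(u) = t]. *)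
have betaE : conjF w = t^-1 *: ((Quat e c t (coef1 w) (coefZ w) 0 0 - red w)
    * Quat e c t (u0 + e * u1) (- u1) 0 0).
  apply: (@scalerI _ _ t) => //; rewrite scalerA divff // scale1r.
  have nu := norm_u; rewrite /norm2 in nu.
  by case: w {ir irZ alphaE ialpha} => ????; congr Quat => /=; rewrite -?nu; ring.
have [b0 b1 _ _] : qge val 0 (conjF w).
  rewrite betaE -[0]addr0; apply: (qgeZ val_v).
    by rewrite -oppr0; apply: (vgeV val_v) => //; rewrite vt.
  apply: (iM _ _); first exact: (qgeB val_v).
  apply: qge_pair; last exact: (vgeN val_v).
  by apply: (val_add val_v) => //; exact: (vge_mulr val_v e_integral).
case: ialpha => /= ia0 ia1 _ _.
have ia3 : integral (coefFZ w) by rewrite -[coefFZ w]opprK; exact: (vgeN val_v).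
split=> //; rewrite -(addrK (e * coefFZ w) (coefF w)).
by apply: (vgeB val_v) => //; exact: (vge_mulr val_v e_integral).
Qed.

(** [F + u] has reduced norm [N u - t = 0], so it annihilates its conjugate, and any nonzero column
    of the image of the conjugate is killed. *)
Lemma exists_killed : exists2 x : 'cV[L]_2, x != 0 &
  phi (Quat e c t u0 u1 1 0) *m x = 0.
Proof.
pose w := Quat e c t u0 u1 1 0.
have phi_w : phi (quat_conj w) != 0.
  rewrite -(rmorph0 phi) (inj_eq (bij_inj phi_bij)); apply/eqP => -[_ _ /eqP].
  by rewrite oppr_eq0 oner_eq0.
have ww : phi w *m phi (quat_conj w) = 0.
  rewrite -[_ *m _](rmorphM phi) mul_quat_conj.
  by rewrite /nrd /= norm_u /norm2 !(mulr0, mulr1, addr0, subr0) subrr scale0r rmorph0.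
have [j xj] : exists j, col j (phi (quat_conj w)) != 0.
  apply: contrapT => /forallNP cols; case/eqP: phi_w; apply/matrixP => i j.
  have /negP := cols j; rewrite negbK => /eqP/colP/(_ i).
  by rewrite !mxE.
by exists (col j (phi (quat_conj w))); rewrite // colE mulmxA ww mul0mx.
Qed.

(** In the basis [x], [Z x] the element [w] acts through the coordinates of [red w] and [red (w Z)];
    these are integral exactly when [w] is. *)
Lemma order_of_lattice : exists2 B : 'M[L]_2, B \in unitmx &
  forall w, (forall i j, integral ((invmx B *m phi w *m B) i j)) <-> qge val 0 w.
Proof.
have [x x0 killed] := exists_killed.
have phiM (a b : Q) : phi (a * b) = phi a *m phi b by rewrite rmorphM.
have phiB (a b : Q) : phi (a - b) = phi a - phi b by rewrite rmorphB.
have phiA (a : L) (w : Q) : phi (a%:A + w) = a%:A + phi w.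
  by rewrite rmorphD /= -[X in _ = X + _](rmorph_alg phi).
have phiZ a (w : Q) : phi (a *: w) = a *: phi w by rewrite linearZ.
have phi_red w : phi w *m x = phi (red w) *m x.
  by apply/eqP; rewrite -subr_eq0 -mulmxBl -phiB sub_red phiM -mulmxA killed mulmx0.
have phi_Z a b : phi (a%:A + b *: ZQ) *m x = a *: x + b *: (phi ZQ *m x).
  by rewrite phiA phiZ mulmxDl -!scalemxAl mul1mx.
pose B : 'M[L]_(2, 1 + 1) := row_mx x (phi ZQ *m x).
pose M (w : Q) : 'M[L]_(1 + 1) := block_mx (coef1 (red w))%:M (coef1 (red (w * ZQ)))%:M
  (coefZ (red w))%:M (coefZ (red (w * ZQ)))%:M.
have BM w : phi w *m B = B *m M w.
  rewrite mul_mx_row mul_row_block !mul_mx_scalar mulmxA -phiM.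
  by rewrite -!phi_Z -!red_split -!phi_red.
(* A linear relation between [x] and [Z x] is an element of [L[Z]] killing [x]. Multiplication by
   its conjugate shows that its norm is 0, so it vanishes. *)
have B_unit : B \in unitmx.
  rewrite unitmxE unitfE -det_tr; apply/negP => /det0P[v v0 vB].
  have vB' : B *m (v^T : 'cV[L]_(1 + 1)) = 0.
    by have := congr1 trmx vB; rewrite trmx_mul trmxK trmx0.
  case/eqP: v0; move: vB'.
  rewrite -[v^T](@vsubmxK _ 1 1 1) /B mul_row_col.
  rewrite [usubmx _]mx11_scalar [dsubmx _]mx11_scalar !mul_mx_scalar.
  set a := usubmx _ _ _; set b := dsubmx _ _ _; rewrite -phi_Z => ab.
  have Nab : norm2 e c a b = 0.
    have : (norm2 e c a b) *: x = 0.
      have := congr1 (mulmx (phi (quat_conj (a%:A + b *: ZQ)))) ab.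
      rewrite mulmx0 mulmxA -phiM mul_conj_quat phiZ rmorph1 -scalemxAl mul1mx.
      by rewrite /nrd /norm2 /= !(mulr0, mul0r, mulr1, addr0, subr0, add0r).
    by move/eqP; rewrite scaler_eq0 (negbTE x0) orbF => /eqP.
  have [a0 b0] := norm2_eq0 Nab; apply: trmx_inj; rewrite -[v^T](@vsubmxK _ 1 1 1) trmx0.
  by rewrite [usubmx _]mx11_scalar [dsubmx _]mx11_scalar -/a -/b a0 b0 !raddf0 col_mx0.
exists B => // w; rewrite -mulmxA BM mulmxA mulVmx // mul1mx.
split=> [iM|iw i j].
  have iM' (i j : 'I_1 + 'I_1) : integral (M w (unsplit i) (unsplit j)) by exact: iM.
  have := iM' (inl 0) (inl 0); have := iM' (inl 0) (inr 0).
  have := iM' (inr 0) (inl 0); have := iM' (inr 0) (inr 0).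
  rewrite /M /= block_mxEul block_mxEur block_mxEdl block_mxEdr !mxE eqxx !mulr1n.
  move=> s1 r1 s0 r0; apply: red_qge; split=> //;
    by rewrite ?coefF_red ?coefFZ_red; left.
have [r0 r1 _ _] := qge_red iw.
have iZ : qge val 0 ZQ by split=> /=; [left|exact: vge1|left|left].
have [s0 s1 _ _] : qge val 0 (red (w * ZQ)).
  apply: qge_red; rewrite -[0]addr0.
  exact: (qgeM val_v e_integral c_integral t_integral).
have i1 a (i' j' : 'I_1) : integral a -> integral (a%:M i' j').
  by rewrite !ord1 mxE mulr1n.
rewrite mxE; case: splitP => i' _; rewrite mxE; case: splitP => j' _; exact: i1.
Qed.

End Splitting.

Lemma exists_order_lattice (phi : {lrmorphism Q -> 'M[L]_2}) : bijective phi ->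
  exists2 B : 'M[L]_2, B \in unitmx &
  forall w, (forall i j, integral ((invmx B *m phi w *m B) i j)) <-> qge val 0 w.
Proof.
move=> phi_bij; have [psi phiK psiK] := phi_bij.
(* A nilpotent matrix pulls back to a nonzero quaternion of square 0, hence of norm 0. *)
pose E : 'M[L]_2 := delta_mx 0 1.
have E0 : E != 0 by apply/eqP => /matrixP/(_ 0 1)/eqP; rewrite !mxE /= oner_eq0.
have w0 : psi E != 0.
  by apply: contraNneq E0 => w0; rewrite -[E]psiK w0 rmorph0.
have ww : psi E * psi E = 0.
  apply: (bij_inj phi_bij); have -> : phi (psi E * psi E) = phi (psi E) *m phi (psi E).
    by rewrite rmorphM.
  by rewrite psiK rmorph0 mul_delta_mx_0.
have /eqP : nrd (psi E) * nrd (psi E) = 0.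
  by rewrite -nrdM ww /nrd /norm2 /=; ring.
rewrite mulf_eq0 orbb => /eqP /(isotropic_norm w0)[u0 [u1 norm_u]].
exact: (order_of_lattice phi_bij norm_u).
Qed.

End UnramifiedPlace.

(** * Vertices of the Bruhat-Tits tree as translates of one lattice *)

Section Vertices.
Variables (Fq : finFieldType) (c : Fq) (v : place Fq) (Kv : completion v).
Variable phi : {lrmorphism Dv c Kv -> 'M[Kv]_2}.
Hypothesis phi_bij : bijective phi.
Local Notation val := (@cval _ _ Kv).
Local Notation Q := (Dv c Kv).
Variable B : 'M[Kv]_2.
Hypothesis B_unit : B \in unitmx.
Hypothesis order_B : forall w : Q,
  (forall i j, val_ge val 0 ((invmx B *m phi w *m B) i j)) <-> qge val 0 w.

Lemma completion_valuation : is_valuation val.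
Proof. by split; [exact: cvalM|exact: cvalD]. Qed.
Let val_v := completion_valuation.

Definition integral_vec : set 'cV[Kv]_2 := [set x | forall i, cintegers (x i 0)].
Definition lattice (g : Q) : set 'cV[Kv]_2 :=
  [set phi g *m (B *m x) | x in integral_vec].
Definition vertex (g : Q) := homothety_class (lattice g).

Lemma integral_mulmx (M : 'M[Kv]_2) :
  (forall x, integral_vec x -> integral_vec (M *m x)) <->
  (forall i j, val_ge val 0 (M i j)).
Proof.
split=> [MO i j|iM x ix i].
  have /MO/(_ i) : integral_vec (delta_mx j 0).
    move=> l; rewrite mxE eqxx andbT; case: eqP => _ /=; last by left.
    exact: (vge1 val_v).
  by rewrite -colE mxE.
rewrite /cintegers /= mxE big_ord_recl big_ord1.
apply: (val_add val_v); apply: (vge_mulr val_v) => //; exact: ix.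
Qed.

Lemma phi_mul (g h : Q) : phi (g * h) = phi g *m phi h.
Proof. by rewrite rmorphM. Qed.

Lemma phi_scale k (g : Q) : phi (k *: g) = k *: phi g.
Proof. by rewrite linearZ. Qed.

Lemma phi_one : phi 1 = 1%:M.
Proof. by rewrite rmorph1. Qed.

(** The order is the endomorphism ring of the standard lattice; this is the property of [B] restated
    without matrices. *)
Lemma qge_lattice1 (h : Q) : qge val 0 h <-> lattice h `<=` lattice 1.
Proof.
rewrite -order_B -integral_mulmx; split=> [hO _ [x ix <-]|sub x ix].
  exists (invmx B *m phi h *m B *m x); first exact: hO.
  by rewrite phi_one mul1mx !mulmxA mulmxV // mul1mx.
have [|y iy] := sub (phi h *m (B *m x)); first by exists x.
rewrite phi_one mul1mx => yx; suff <- : y = invmx B *m phi h *m B *m x by [].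
by rewrite -!mulmxA -yx mulmxA mulVmx // mul1mx.
Qed.

Lemma lattice_image (g h : Q) : lattice (g * h) = [set phi g *m x | x in lattice h].
Proof.
apply/seteqP; split=> [_ [x ix <-]|_ [_ [x ix <-] <-]].
  by exists (phi h *m (B *m x)); [exists x|rewrite phi_mul !mulmxA].
by exists x => //; rewrite phi_mul !mulmxA.
Qed.

Lemma lattice_unit (g h : Q) : nrd h != 0 -> qge val 0 h -> qge val 0 (quat_inv h) ->
  lattice (g * h) = lattice g.
Proof.
move=> h0 /qge_lattice1 hL /qge_lattice1 hV.
rewrite lattice_image -[in RHS](mulr1 g) [RHS]lattice_image; congr (image _ _).
apply/seteqP; split=> // y; rewrite -{1}(mul_quat_inv h0) lattice_image.
move=> [z /hV z1 <-]; by rewrite -[X in lattice X](mulr1 h) lattice_image; exists z.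
Qed.

Lemma latticeZ k (g : Q) : lattice (k *: g) = [set k *: x | x in lattice g].
Proof.
apply/seteqP; split=> [_ [x ix <-]|_ [_ [x ix <-] <-]].
  by exists (phi g *m (B *m x)); [exists x|rewrite phi_scale scalemxAl].
by exists x => //; rewrite phi_scale scalemxAl.
Qed.

Lemma vertexE (g : Q) : vertex g = [set lattice (k *: g) | k in [set k | k != 0]].
Proof. by rewrite /vertex /homothety_class; apply: eq_imagel => k _; rewrite latticeZ. Qed.

Lemma vertex_image (h g : Q) :
  vertex (h * g) = [set [set phi h *m x | x in L] | L in vertex g].
Proof.
rewrite !vertexE; apply/seteqP; split=> [_ [k k0 <-]|_ [_ [k k0 <-] <-]].
  by exists (lattice (k *: g)); [exists k|rewrite -lattice_image scalerAr].
by exists k => //; rewrite -lattice_image scalerAr.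
Qed.

Lemma vertexZ k (g : Q) : k != 0 -> vertex (k *: g) = vertex g.
Proof.
move=> k0; rewrite !vertexE; apply/seteqP; split=> _ [l /= l0 <-].
  by exists (l * k); rewrite /= ?mulf_neq0 // scalerA.
by exists (l / k); rewrite /= ?mulf_neq0 ?invr_eq0 // scalerA divfK.
Qed.

Lemma vertex_unit (g h : Q) : nrd h != 0 -> qge val 0 h -> qge val 0 (quat_inv h) ->
  vertex (g * h) = vertex g.
Proof. by move=> h0 ih iV; rewrite /vertex lattice_unit. Qed.

(** Equality of homothety classes means that some multiple of [g] maps the standard lattice onto
    itself, so this multiple and its inverse are both endomorphisms of it. *)
Lemma vertex_stabiliser (g : Q) : nrd g != 0 -> vertex g = vertex 1 ->
  exists k, [/\ k != 0, qge val 0 (k *: g) & qge val 0 (quat_inv (k *: g))].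
Proof.
move=> g0 gV; have : vertex g (lattice g).
  by rewrite vertexE; exists 1; rewrite /= ?oner_neq0 // scale1r.
rewrite gV vertexE => -[k /= k0 kg]; exists k^-1; split; first by rewrite invr_eq0.
  by apply/qge_lattice1; rewrite latticeZ -kg -latticeZ scalerA mulVf // scale1r.
apply/qge_lattice1; rewrite quat_inv_scale ?invr_eq0 // invrK -[_ *: _]mulr1.
rewrite lattice_image => _ [x x1 <-].
have : lattice (k *: 1) (k *: x) by rewrite latticeZ; exists x.
rewrite kg -[X in lattice X]mulr1 lattice_image => -[y y1 yx].
by rewrite phi_scale -scalemxAl scalemxAr -yx mulmxA -phi_mul mul_inv_quat // phi_one mul1mx.
Qed.

(** A lattice with basis matrix [C] is the translate of the standard one by [C * invmx B], which
    lies in the image of [phi]. *)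
Lemma tree_vertexP P : tree_vertex P <-> exists2 g, nrd g != 0 & P = vertex g.
Proof.
have [psi phiK psiK] := phi_bij.
split=> [[_ [C C_unit ->] <-]|[g g0 ->]].
  exists (psi (C *m invmx B)); last first.
    rewrite /vertex /lattice psiK; congr homothety_class.
    by apply: eq_imagel => x _; rewrite -!mulmxA mulKmx.
  (* With norm 0 the element would be annihilated by its conjugate; its image being invertible,
     first the conjugate and then the element itself would vanish. *)
  apply/eqP => N0.
  have : psi (C *m invmx B) * quat_conj (psi (C *m invmx B)) = 0.
    by rewrite mul_quat_conj N0 scale0r.
  move/(congr1 phi); rewrite phi_mul psiK rmorph0.
  move/(congr1 (mulmx (B *m invmx C))); rewrite mulmx0 mulmxA -[_ *m (C *m _)]mulmxA.
  rewrite (mulmxA (invmx C)) mulVmx // mul1mx mulmxV // mul1mx => conj0.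
  have psi0 : psi (C *m invmx B) = 0.
    rewrite -[LHS]quat_conjK -[RHS]quat_conj0; congr quat_conj.
    by apply: (bij_inj phi_bij); rewrite conj0 rmorph0.
  move/(congr1 phi): psi0; rewrite psiK rmorph0 => /(congr1 (mulmx (invmx C))).
  rewrite mulmxA mulVmx // mul1mx mulmx0 => /(congr1 (mulmx B)).
  by rewrite mulmxV // mulmx0 => /eqP; rewrite oner_eq0.
exists (lattice g) => //; exists (phi g *m B); last first.
  by apply: eq_imagel => x _; rewrite mulmxA.
rewrite unitmx_mul B_unit andbT.
have := mulmx1_unit (A := phi g) (B := phi (quat_inv g)).
by rewrite -phi_mul mul_quat_inv // phi_one => /(_ erefl)[].
Qed.

End Vertices.

(** * Reduction at a rational place *)

Section FiniteField.
Variable Fq : finFieldType.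
Local Notation K := {fraction {poly Fq}}.
Local Notation frac := FracField.tofrac.

(** [(-1)^q = -1] in a field with [q] elements, and the left side is 1 for even [q]. *)
Lemma finField_even : ~~ odd #|Fq| -> 1 + 1 = 0 :> Fq.
Proof.
move=> even; have := finfield.expf_card (-1 : Fq).
by rewrite -signr_odd (negbTE even) expr0 => {2}->; rewrite subrr.
Qed.

(** If [2 = 0], the additive group is an elementary abelian 2-group, so its order is a power of
    2. *)
Lemma finField_odd : odd #|Fq| -> 2%:R != 0 :> Fq.
Proof.
move=> oddq; apply/eqP => two0.
have /abelian.fin_ring_pchar_abelem/abelian.abelem_pgroup : 2%N \in [pchar Fq] by rewrite inE two0 eqxx.
rewrite /pgroup.pgroup finset.cardsT => q2; have q2' : (2^')%N.-nat #|Fq| by rewrite -odd_2'nat.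
by have := finfield.finNzRing_gt1 Fq; rewrite (pnat_1 q2 q2').
Qed.

Definition eFq : Fq := if odd #|Fq| then 0 else 1.

Lemma eKE : eK Fq = constK eFq.
Proof. by rewrite /eK /eFq /constK; case: ifP; rewrite ?polyC0 ?tofrac0 ?tofrac1. Qed.

Variable c : Fq.
Hypothesis hc : admissible c.

(** A zero with [b] nonzero would make [a / b] a square root of [c] for odd [q], and a root of
    [X^2 + X + c] for even [q]. *)
Lemma norm2_anisotropic (a b : Fq) : norm2 eFq c a b = 0 -> a = 0 /\ b = 0.
Proof.
have [->|b0] := eqVneq b 0.
  by rewrite /norm2 !mulr0 addr0 subr0 => /eqP; rewrite mulf_eq0 orbb => /eqP.
move: hc; rewrite /norm2 /eFq /admissible.
case: ifPn => [_ /(_ (a / b)) nc|even irr].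
  rewrite mul0r addr0 => /eqP; rewrite subr_eq0 => /eqP N0.
  by case/eqP: nc; rewrite expr2 mulf_div N0 mulfK ?mulf_neq0.
rewrite mul1r => N0; have two0 := finField_even even.
have root_r : root ('X^2 + 'X + c%:P) (a / b).
  rewrite /root !hornerE /= expr2 mulf_div; apply/eqP.
  (* The signs of [c] in the polynomial and in the norm form differ; the correction [2c] vanishes in
     characteristic 2. *)
  have -> : a * a / (b * b) + a / b + c = (a * a + a * b - c * (b * b)) / (b * b) + (1 + 1) * c.
    by field.
  by rewrite N0 two0 !mul0r addr0.
have [_ /(_ ('X - (a / b)%:P))] := irr.
rewrite size_XsubC dvdp_XsubCl root_r => /(_ erefl erefl) /eqp_size.
have -> : size ('X^2 + 'X + c%:P) = 3; last by rewrite size_XsubC.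
by rewrite -addrA size_polyDl ?size_polyXn // size_polyDl ?size_polyX ?(leq_ltn_trans (size_polyC_leq1 _)).
Qed.

Lemma discriminant_neq0 : eFq * eFq + 4%:R * c != 0.
Proof.
move: hc; rewrite /eFq /admissible; case: ifPn => [oddq nc|even _].
  rewrite mul0r add0r mulf_neq0 //.
    by rewrite (natrM _ 2 2) mulf_neq0 // finField_odd.
  by have := nc 0; rewrite expr0n eq_sym.
by rewrite (natrM _ 2 2) (natrD _ 1 1) (finField_even even) !mul0r addr0 mulr1 oner_neq0.
Qed.

Definition constK_rmorphism : {rmorphism Fq -> K} := (@FracField.tofrac {poly Fq} \o @polyC Fq)%FUN.

Lemma constKE a : constK a = constK_rmorphism a. Proof. by []. Qed.

Lemma ord_valuation (p : {poly Fq}) : irreducible_poly p -> is_valuation (ord (Some p)).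
Proof. by move=> irr; split; [exact: ordM|exact: ordD]. Qed.

Lemma ord_const (p : {poly Fq}) a : irreducible_poly p -> a != 0 ->
  ord (Some p) (constK a) = 0.
Proof.
move=> irr a0; rewrite ord_poly ?polyC_eq0 // multiplicity_eq0 ?polyC_eq0 //; apply/negP => /dvdp_leq.
have [sp _] := irr; rewrite polyC_eq0 size_polyC a0 => /(_ isT); lia.
Qed.

Lemma tK_sub a : tK Fq - constK a = frac ('X - a%:P).
Proof. by rewrite tofracB. Qed.

(** [1 + F b] for [b = b0 + b1 Z], with [F] on the left as in the coordinates of [quat]. *)
Definition neighbour (b0 b1 : Fq) : D c := Quat _ _ _ 1 0 (constK b0) (constK b1).

(** The left divisors used in the descent. The scalar moves no vertex; the other elements represent
    the classes of [PA] at [tau]. *)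
Definition is_step (tau : Fq) (s : D c) : Prop := s = (tK Fq - constK tau)%:A \/
  exists b0 b1, norm2 eFq c b0 b1 = tau^-1 /\ s = neighbour b0 b1.

Lemma constK_norm2 b0 b1 :
  norm2 (eK Fq) (constK c) (constK b0) (constK b1) = constK (norm2 eFq c b0 b1).
Proof. by rewrite eKE /norm2 !constKE !(rmorphD, rmorphN, rmorphM). Qed.

Lemma nrd_neighbour tau b0 b1 : tau != 0 -> norm2 eFq c b0 b1 = tau^-1 ->
  nrd (neighbour b0 b1) = - constK tau^-1 * (tK Fq - constK tau).
Proof.
move=> tau0 Nb; have kk : constK tau^-1 * constK tau = 1.
  by rewrite !constKE -rmorphM mulVf // rmorph1.
rewrite /nrd /= constK_norm2 Nb mulrBr (mulNr _ (constK tau)) kk /norm2; ring.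
Qed.

(** * Completions at finite rational places *)

Section LocalField.
Variables (tau : Fq) (v : place Fq) (Kv : completion v).
Hypothesis vE : v = Some ('X - tau%:P).
Local Notation val := (@cval _ _ Kv).
Local Notation iota := (cembed Kv \o constK_rmorphism)%FUN.

Lemma cembed_constK a : cembed Kv (constK a) = iota a. Proof. by []. Qed.

Lemma ord_XsubC (a : Fq) :
  ord v (tK Fq - constK a) = if a == tau then 1 else 0.
Proof.
rewrite vE tK_sub ord_poly ?polyXsubC_eq0 //; last exact: irredp_XsubC.
case: eqP => [->|/eqP neq].
  have irr := irredp_XsubC tau; congr Posz.
  rewrite -[X in multiplicity _ X]mulr1 -{2}['X - _]expr1 multiplicity_factor //.
  by rewrite dvdp1 size_XsubC.
rewrite multiplicity_eq0 ?polyXsubC_eq0 //; first exact: irredp_XsubC.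
by rewrite dvdp_XsubCl root_XsubC eq_sym.
Qed.

Lemma val_const a : a != 0 -> val (iota a) = 0.
Proof.
move=> a0; rewrite -cembed_constK cval_embed ?tofrac_eq0 ?polyC_eq0 //.
by rewrite vE ord_const //; exact: irredp_XsubC.
Qed.

(** By density it suffices to treat an element of [K] with no pole at [tau]; its residue is its
    value there. *)
Lemma residue_field x : val_ge val 0 x -> exists a, val_ge val 1 (x - iota a).
Proof.
move=> ix; have [y xy] := cdense x 1.
have val_v := completion_valuation Kv.
have iy : val_ge val 0 (cembed Kv y).
  rewrite -(subKr x (cembed Kv y)); apply: (vgeB val_v) => //.
  exact: vge_le xy.
suff [a ya] : exists a, val_ge val 1 (cembed Kv y - iota a).
  exists a; rewrite -(subrK (cembed Kv y) x) -addrA; exact: (val_add val_v).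
have [->|y0] := eqVneq y 0.
  by exists 0; rewrite !rmorph0 subr0; left.
have := iy; rewrite vgeE ?fmorph_eq0 // cval_embed // {1}vE.
have irr := irredp_XsubC tau.
move=> /(ord_ge0P irr y0)[f [g [pg yE]]].
have g0 : g != 0 by apply: contraNneq pg => ->; exact: dvdp0.
have gt0 : g.[tau] != 0 by rewrite -[_ == 0]/(root g tau) -dvdp_XsubCl.
exists (f.[tau] / g.[tau]); rewrite -cembed_constK -rmorphB yE.
have -> : frac f / frac g - constK (f.[tau] / g.[tau]) =
    frac (f - (f.[tau] / g.[tau]) *: g) / frac g.
  by rewrite -mul_polyC tofracB tofracM mulrBl mulfK ?tofrac_eq0.
have [->|num0] := eqVneq (f - (f.[tau] / g.[tau]) *: g) 0.
  by rewrite tofrac0 mul0r rmorph0; left.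
right; rewrite cval_embed ?mulf_neq0 ?invr_eq0 ?tofrac_eq0 // vE ord_frac //.
rewrite (multiplicity_eq0 irr g0 pg) subr0 lez_nat multiplicity_gt0 //.
by rewrite dvdp_XsubCl /root !hornerE /= divfK // subrr.
Qed.

Hypothesis tau_neq0 : tau != 0.
Let val_v := completion_valuation Kv.
Local Notation W := (Dv c Kv).

Lemma eK_cembed : cembed Kv (eK Fq) = iota eFq.
Proof. by rewrite eKE. Qed.

Lemma tK_sub_neq0 a : tK Fq - constK a != 0.
Proof. by rewrite tK_sub tofrac_eq0 polyXsubC_eq0. Qed.

Lemma tK_sub_val a : val (cembed Kv (tK Fq - constK a)) = if a == tau then 1 else 0.
Proof. by rewrite cval_embed ?tK_sub_neq0 // ord_XsubC. Qed.

Lemma local_pi : cembed Kv (tK Fq) - iota tau != 0.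
Proof. by rewrite -cembed_constK -rmorphB fmorph_eq0 tK_sub_neq0. Qed.

Lemma val_local_pi : val (cembed Kv (tK Fq) - iota tau) = 1.
Proof. by rewrite -cembed_constK -rmorphB tK_sub_val eqxx. Qed.

Lemma local_order_lattice (phi : {lrmorphism W -> 'M[Kv]_2}) : bijective phi ->
  exists2 B : 'M[Kv]_2, B \in unitmx &
  forall w : W, (forall i j, val_ge val 0 ((invmx B *m phi w *m B) i j)) <-> qge val 0 w.
Proof.
exact: (exists_order_lattice val_v norm2_anisotropic discriminant_neq0 tau_neq0
  val_const residue_field eK_cembed (erefl _) local_pi val_local_pi).
Qed.

Lemma local_e_integral : val_ge val 0 (cembed Kv (eK Fq)).
Proof. exact: (e_integral val_const eK_cembed). Qed.

Lemma local_c_integral : val_ge val 0 (cembed Kv (constK c)).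
Proof. exact: (c_integral val_const (erefl _)). Qed.

Lemma local_t_integral : val_ge val 0 (cembed Kv (tK Fq)).
Proof. exact: (t_integral val_v tau_neq0 val_const val_local_pi). Qed.

(** A step at [a] is a unit at every other place, so that descending at one place does not disturb
    the others. *)
Lemma step_integral a (s : D c) (m : W := quat_map (cembed Kv) s) : a != 0 -> is_step a s ->
  [/\ nrd m != 0, qge val 0 m & a != tau -> val (nrd m) = 0].
Proof.
move=> a0 step; have pi0 := tK_sub_neq0 a; have vpi := tK_sub_val a.
rewrite /m nrd_map; case: step => [->|[b0 [b1 [Nb ->]]]].
  have ipi : val_ge val 0 (cembed Kv (tK Fq - constK a)).
    by rewrite vgeE ?fmorph_eq0 // vpi; case: ifP.
  rewrite nrdZ nrd1 mulr1; split.
  - by rewrite fmorph_eq0 expf_neq0.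
  - rewrite quat_mapZ quat_map1 -[0]addr0; apply: (qgeZ val_v) => //; exact: (qge1 val_v).
  - by move=> /negbTE neq; rewrite rmorphXn /= (val_exp val_v) ?fmorph_eq0 // vpi neq.
have ca0 : constK a^-1 != 0 by rewrite tofrac_eq0 polyC_eq0 invr_eq0.
have nca0 : - constK a^-1 != 0 by rewrite oppr_eq0.
rewrite (nrd_neighbour a0 Nb) fmorph_eq0; split.
- exact: (mulf_neq0 nca0 pi0).
- split=> /=; rewrite ?rmorph1 ?rmorph0 ?cembed_constK.
  + exact: (vge1 val_v).
  + by left.
  + exact: (iota_integral val_const).
  + exact: (iota_integral val_const).
- move=> /negbTE neq; have ia0 : iota a^-1 != 0 by rewrite fmorph_eq0 invr_eq0.
  have pa0 : cembed Kv (tK Fq - constK a) != 0 by rewrite fmorph_eq0 tK_sub_neq0.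
  rewrite rmorphM rmorphN mulNr (val_opp val_v (mulf_neq0 ia0 pa0)) (val_mul val_v ia0 pa0).
  by rewrite vpi neq addr0 val_const ?invr_eq0.
Qed.

(** If [t - tau] divides [g], this scalar is the step: its norm has valuation 2, one factor coming
    from [g] and one from the scalar. Otherwise the step is some [1 + F b], with norm of valuation
    1. *)
Lemma step_exists (g : W) : qge val 0 g -> nrd g != 0 -> 0 < val (nrd g) ->
  exists s : D c, let m : W := quat_map (cembed Kv) s in
  [/\ is_step tau s, 0 < val (nrd m) & qge val (val (nrd m)) (quat_conj m * g)].
Proof.
move=> ig g0 vg; have sg : val_ge val 1 (nrd g) by right; lia.
have [g1|[b0 [b1 [Nb nb]]]] := neighbour_step val_v norm2_anisotropic tau_neq0
  val_const residue_field eK_cembed (erefl _) val_local_pi ig sg.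
  pose s : D c := (tK Fq - constK tau)%:A.
  have mE : quat_map (cembed Kv) s = (cembed Kv (tK Fq - constK tau))%:A :> W.
    by rewrite /s quat_mapZ quat_map1.
  have vm : val (nrd (quat_map (cembed Kv) s : W)) = 1 + 1.
    by rewrite mE nrdZ nrd1 mulr1 (val_exp val_v) ?fmorph_eq0 ?tK_sub_neq0 // tK_sub_val eqxx.
  exists s; split; [by left|by rewrite vm|rewrite vm].
  have -> : quat_conj (quat_map (cembed Kv) s) * g = cembed Kv (tK Fq - constK tau) *: g.
    rewrite mE -[X in _ = _ *: X]mul1r scalerAl; congr (_ * g).
    by apply: quatP => /=; ring.
  apply: (qgeZ val_v) => //.
  by rewrite vgeE ?fmorph_eq0 ?tK_sub_neq0 // tK_sub_val eqxx.
have mE : quat_map (cembed Kv) (neighbour b0 b1) = Quat _ _ _ 1 0 (iota b0) (iota b1) :> W.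
  by congr Quat; rewrite ?rmorph0 ?rmorph1.
have vm : val (nrd (quat_map (cembed Kv) (neighbour b0 b1) : W)) = 1.
  have ca0 : constK tau^-1 != 0 by rewrite tofrac_eq0 polyC_eq0 invr_eq0.
  rewrite nrd_map (nrd_neighbour tau_neq0 Nb) rmorphM rmorphN /= (val_mul val_v)
    ?oppr_eq0 ?fmorph_eq0 ?tK_sub_neq0 //.
  by rewrite (val_opp val_v) ?fmorph_eq0 // tK_sub_val eqxx val_const ?invr_eq0.
by exists (neighbour b0 b1); split; [right; exists b0, b1|rewrite vm|rewrite vm mE].
Qed.

End LocalField.

End FiniteField.

(** * S-arithmetic units and the congruence subgroup at t = 0 *)

Section SArithmetic.
Variables (Fq : finFieldType) (c : Fq) (S : {set option Fq}).
Hypothesis hS : placesB Fq \subset S.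
Local Notation K := {fraction {poly Fq}}.
Local Notation frac := FracField.tofrac.

(** As [S] contains infinity, S-integrality is a condition at these finite places only. *)
Definition outside (p : {poly Fq}) : Prop :=
  [/\ p \is monic, irreducible_poly p & forall a, Some a \in S -> p <> 'X - a%:P].

Lemma infty_in_S : None \in S.
Proof. by apply: (fintype.subsetP hS); rewrite !inE eqxx orbT. Qed.

Lemma S_integerE (x : K) :
  S_integer S x <-> forall p, outside p -> val_ge (ord (Some p)) 0 x.
Proof.
split=> [ix p [mp irr pS]|ix [p [mp irr] pS|_ /(_ None infty_in_S)//]].
  apply: ix => // -[a|]; last by [].
  by move=> aS /= [/(pS a aS)].
by apply: ix; split=> // a aS pE; apply: (pS (Some a)) => //=; rewrite pE.
Qed.

Lemma ord_poly_ge0 p (f : {poly Fq}) : irreducible_poly p ->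
  val_ge (ord (Some p)) 0 (frac f).
Proof.
move=> irr; have [->|f0] := eqVneq f 0; first by left.
by right; rewrite ord_poly.
Qed.

Lemma eK_ge0 p : irreducible_poly p -> val_ge (ord (Some p)) 0 (eK Fq).
Proof. by rewrite eKE; exact: ord_poly_ge0. Qed.

Lemma orderAE (w : D c) :
  orderA S w <-> forall p, outside p -> qge (ord (Some p)) 0 w.
Proof.
split=> [[i0 i1 i2 i3] p op|iw].
  by split; apply: (proj1 (S_integerE _)).
by split; apply/S_integerE => p /iw[].
Qed.

Lemma orderA_unitE (w : D c) :
  orderA_unit S w <-> [/\ nrd w != 0, orderA S w & orderA S (quat_inv w)].
Proof.
split=> [[iw [w' [iw' ww' _]]]|[w0 iw iV]].
  by have [w0 w'E] := quat_mul1_inv ww'; rewrite -w'E.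
by split=> //; exists (quat_inv w); rewrite mul_quat_inv // mul_inv_quat.
Qed.

Lemma orderAM (w w' : D c) : orderA S w -> orderA S w' -> orderA S (w * w').
Proof.
move=> /orderAE iw /orderAE iw'; apply/orderAE => p op; have [_ irr _] := op.
apply: (qgeM0 (ord_valuation irr) (eK_ge0 irr) (ord_poly_ge0 _ irr) (ord_poly_ge0 _ irr)
  (iw p op) (iw' p op)).
Qed.

Lemma orderA1 : orderA S (1 : D c).
Proof.
by apply/orderAE => p [_ irr _]; apply: qge1; exact: ord_valuation.
Qed.

Lemma orderA_unitM (w w' : D c) :
  orderA_unit S w -> orderA_unit S w' -> orderA_unit S (w * w').
Proof.
move=> /orderA_unitE[w0 iw iV] /orderA_unitE[w0' iw' iV']; apply/orderA_unitE.
split; [exact: (nrdM_neq0 w0 w0')|exact: orderAM|].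
rewrite (quat_invM w0 w0'); exact: orderAM.
Qed.

Lemma orderA_unitV (w : D c) : orderA_unit S w -> orderA_unit S (quat_inv w).
Proof.
move=> /orderA_unitE[w0 iw iV]; apply/orderA_unitE.
by rewrite (quat_invK w0); split; [exact: (nrd_inv_neq0 w0)|exact: iV|exact: iw].
Qed.

Lemma orderA_unit1 : orderA_unit S (1 : D c).
Proof.
apply/orderA_unitE; rewrite nrd1 quat_inv1.
by split; [exact: oner_neq0|exact: orderA1|exact: orderA1].
Qed.

Lemma S_integerM (x y : K) : S_integer S x -> S_integer S y -> S_integer S (x * y).
Proof.
move=> /S_integerE ix /S_integerE iy; apply/S_integerE => p op; have [_ irr _] := op.
by apply: (vge_mulr (ord_valuation irr)); [exact: ix|exact: iy].
Qed.

Lemma S_unit1 : S_unit S (1 : K).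
Proof.
have i1 : S_integer S (1 : K).
  by apply/S_integerE => p [_ irr _]; exact: vge1 (ord_valuation irr).
by split; rewrite ?oner_neq0 ?invr1.
Qed.

Lemma S_unitM (x y : K) : S_unit S x -> S_unit S y -> S_unit S (x * y).
Proof.
move=> [x0 [ix iVx]] [y0 [iy iVy]]; split; first exact: (mulf_neq0 x0 y0).
by rewrite invfM; split; [exact: S_integerM ix iy|exact: S_integerM iVx iVy].
Qed.

Lemma S_unitV (x : K) : S_unit S x -> S_unit S x^-1.
Proof. by move=> [x0 [ix iVx]]; split; [rewrite invr_eq0|rewrite invrK]. Qed.

Lemma coset_classM (w w' : D c) :
  class_mul (coset_class S w) (coset_class S w') = coset_class S (w * w').
Proof.
apply/seteqP; split=> [_ [_ [k kS <-] [_ [l lS <-] <-]]|_ [k kS <-]].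
  by exists (k * l); [exact: S_unitM|rewrite -scalerAl -scalerAr scalerA].
exists (k *: w); first by exists k.
by exists w'; [exists 1; [exact: S_unit1|rewrite scale1r]|rewrite scalerAl].
Qed.

Lemma coset_classV (w : D c) : nrd w != 0 ->
  class_inv (coset_class S w) = coset_class S (quat_inv w).
Proof.
move=> w0; apply/seteqP; split=> [y [_ [[k kS <-] xy _]]|_ [k kS <-]].
  exists k^-1; first exact: S_unitV.
  have [k0 _] := kS.
  rewrite -(quat_inv_scale k0 w0); symmetry; exact: (proj2 (quat_mul1_inv xy)).
have [k0 _] := kS; exists (k^-1 *: w).
split; first by exists k^-1; [exact: S_unitV|].
  by rewrite -scalerAl -scalerAr scalerA (mulVf k0) scale1r (mul_quat_inv w0).
by rewrite -scalerAl -scalerAr scalerA (divff k0) scale1r (mul_inv_quat w0).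
Qed.

Lemma class_self (w : D c) : coset_class S w w.
Proof. by exists 1; [exact: S_unit1|rewrite scale1r]. Qed.

Lemma classes_subgroup (X : set (D c)) :
  X `<=` orderA_unit S -> X 1 -> (forall w w', X w -> X w' -> X (w * w')) ->
  (forall w, X w -> X (quat_inv w)) ->
  is_subgroup S [set coset_class S w | w in X].
Proof.
move=> XA X1 XM XV; split.
- by move=> _ [w Xw <-]; exists w => //; exact: XA.
- by exists 1.
- by move=> _ _ [w Xw <-] [w' Xw' <-]; exists (w * w'); [exact: XM|rewrite coset_classM].
- move=> _ [w Xw <-]; exists (quat_inv w); first exact: XV.
  by have /orderA_unitE[w0 _ _] := XA _ Xw; rewrite (coset_classV w0).
Qed.

(** * The congruence condition at the ramified place t = 0 *)

Local Notation ord0 := (ord (Some 'X)).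

Lemma X_irreducible : irreducible_poly ('X : {poly Fq}).
Proof. by rewrite -['X]subr0 -polyC0; exact: irredp_XsubC. Qed.

Let ord0_v := ord_valuation X_irreducible.

(* [1 + F O_0], where [O_0] is the maximal order at the ramified place [t = 0];
   its uniformiser is [F]. *)
Definition one_unit (w : D c) : Prop :=
  [/\ val_ge ord0 1 (coef1 w - 1), val_ge ord0 1 (coefZ w),
      val_ge ord0 0 (coefF w) & val_ge ord0 0 (coefFZ w)].

Lemma tK_ord0 : val_ge ord0 1 (tK Fq).
Proof.
right; rewrite ord_poly ?polyX_eq0 //; last exact: X_irreducible.
rewrite lez_nat multiplicity_gt0 ?polyX_eq0 //; exact: X_irreducible.
Qed.

Lemma one_unit_qge (w : D c) : one_unit w -> qge ord0 0 w.
Proof.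
move=> [i0 i1 i2 i3]; split=> //; last exact: vge_le i1.
rewrite -(subrK 1 (coef1 w)); apply: (val_add ord0_v); last exact: (vge1 ord0_v).
exact: vge_le i0.
Qed.

(** The F-coordinates enter the coordinates at 1 and Z of a product only with a factor [t], which
    has positive valuation. *)
Lemma one_unitM (w w' : D c) : one_unit w -> one_unit w' -> one_unit (w * w').
Proof.
move=> u u'; have iw := one_unit_qge u; have iw' := one_unit_qge u'.
have iE := eK_ge0 X_irreducible; have iC := ord_poly_ge0 c%:P X_irreducible.
have iT := ord_poly_ge0 'X X_irreducible.
have [_ _ iF iFZ] : qge ord0 0 (w * w').
  exact: (qgeM0 ord0_v iE iC iT iw iw').
have st := tK_ord0; have add := val_add ord0_v; have sub := vgeB ord0_v.
have mul n (x y : K) : val_ge ord0 0 x -> val_ge ord0 n y -> val_ge ord0 n (x * y).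
  exact: (vge_mulr ord0_v).
have mulC n (x y : K) : val_ge ord0 n x -> val_ge ord0 0 y -> val_ge ord0 n (x * y).
  by rewrite mulrC => ? ?; exact: mul.
split=> //; case: w w' u u' iw iw' {iF iFZ} => a0 a1 a2 a3 [b0 b1 b2 b3];
  move=> [/= sa0 sa1 _ _] [/= sb0 sb1 _ _] [/= ia0 ia1 ia2 ia3] [/= ib0 ib1 ib2 ib3].
- rewrite addrAC; apply: (add); last first.
    apply: (mulC) => //; apply: (sub); last by apply: (mul) => //; exact: mul.
    by apply: (mul) => //; apply: (add) => //; exact: mul.
  rewrite addrAC; apply: (add); last by apply: (mul) => //; exact: mul.
  have -> : a0 * b0 - 1 = (a0 - 1) * b0 + (b0 - 1) by ring.
  by apply: (add) => //; exact: mulC.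
- apply: (add); last by apply: (mulC) => //; apply: (sub); exact: mul.
  apply: (add); last by apply: (mul) => //; exact: mul.
  by apply: (add); [exact: mul|exact: mulC].
Qed.

Lemma one_unit_conj (w : D c) : one_unit w -> one_unit (quat_conj w).
Proof.
move=> [i0 i1 i2 i3]; split=> /=; try exact: (vgeN ord0_v).
rewrite addrAC; apply: (val_add ord0_v) => //.
by apply: (vge_mulr ord0_v) => //; exact: eK_ge0 X_irreducible.
Qed.

Lemma one_unit_nrd (w : D c) : one_unit w -> val_ge ord0 1 (nrd w - 1).
Proof.
move=> u; have [] := one_unitM (one_unit_conj u) u.
by rewrite mul_conj_quat /= mulr1.
Qed.

Lemma one_unit1 : one_unit 1.
Proof. by split=> /=; rewrite ?subrr; left. Qed.

(** The scalar [k] frees the congruence from the choice of a representative of the class and makes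
    the condition stable under inversion. *)
Definition congruence_unit (w : D c) : Prop :=
  orderA_unit S w /\ exists2 k, k != 0 & one_unit (k *: w).

Lemma congruence_subgroup : is_subgroup S [set coset_class S w | w in congruence_unit].
Proof.
apply: classes_subgroup.
- by move=> w [].
- split; first exact: orderA_unit1.
  by exists 1; rewrite ?oner_neq0 // scale1r; exact: one_unit1.
- move=> w w' [wA [k k0 ku]] [wA' [k' k0' ku']]; split; first exact: orderA_unitM.
  exists (k * k'); first exact: (mulf_neq0 k0 k0').
  by rewrite -scalerA scalerAr scalerAl; exact: one_unitM.
- move=> w [wA [k k0 ku]]; split; first exact: orderA_unitV.
  (* The factor [nrd w] cancels the denominator of [quat_inv w], leaving the conjugate of
     [k *: w]. *)
  have /orderA_unitE[w0 _ _] := wA; exists (k * nrd w); first exact: (mulf_neq0 k0 w0).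
  rewrite scalerA (mulfK w0).
  have -> : k *: quat_conj w = quat_conj (k *: w) by apply: quatP => /=; ring.
  exact: one_unit_conj.
Qed.

Lemma neighbour_unit tau b0 b1 : tau != 0 -> Some tau \in S ->
  norm2 (eFq Fq) c b0 b1 = tau^-1 -> congruence_unit (neighbour c b0 b1).
Proof.
move=> tau0 tauS Nb; have nE := nrd_neighbour tau0 Nb.
have ca0 : constK tau^-1 != 0 by rewrite tofrac_eq0 polyC_eq0 invr_eq0.
have nca0 : - constK tau^-1 != 0 by rewrite oppr_eq0.
have n0 : nrd (neighbour c b0 b1) != 0 by rewrite nE; exact: (mulf_neq0 nca0 (tK_sub_neq0 tau)).
have iN p : irreducible_poly p -> qge (ord (Some p)) 0 (neighbour c b0 b1).
  by move=> irr; split; exact: ord_poly_ge0.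
split.
  apply/orderA_unitE; split=> //; first by apply/orderAE => p [_ irr _]; exact: iN.
  apply/orderAE => p [mp irr pS]; have v := ord_valuation irr.
  (* The norm is a nonzero constant times [t - tau], and [p] differs from [t - tau], so the norm is
     a unit at [p]. *)
  apply: (qge_quat_inv v (eK_ge0 irr)) => //.
    rewrite nE (val_mul v nca0 (tK_sub_neq0 tau)) (val_opp v ca0) ord_const ?invr_eq0 //.
    rewrite add0r tK_sub ord_poly ?polyXsubC_eq0 //.
    rewrite multiplicity_eq0 ?polyXsubC_eq0 //; apply/negP => pX.
    apply: (pS tau tauS); apply/eqP; rewrite -eqp_monic ?monicXsubC //.
    have [_ div] := irredp_XsubC tau; apply: div => //.
    by have [sp _] := irr; rewrite neq_ltn sp orbT.
  exact: iN.
exists 1; rewrite ?oner_neq0 // scale1r; split=> /=; rewrite ?subrr; try by left.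
  exact: (ord_poly_ge0 b0%:P X_irreducible).
exact: (ord_poly_ge0 b1%:P X_irreducible).
Qed.

End SArithmetic.

(** * Units fixing the standard vertex *)

Lemma monic_irreducible_divisor (F : fieldType) (f : {poly F}) : (1 < size f)%N ->
  exists p, [/\ p \is monic, irreducible_poly p & p %| f].
Proof.
elim: {f}(size f) {-2}f (leqnn (size f)) => [|n IH] f sf f1; first by lia.
have f0 : f != 0 by rewrite -size_poly_gt0; apply: ltnW.
have l0 : (lead_coef f)^-1 != 0 by rewrite invr_eq0 lead_coef_eq0.
have [irr|/not_andP[//|/existsNP[q]]] := pselect (irreducible_poly f).
  exists ((lead_coef f)^-1 *: f); split.
  - by rewrite monicE lead_coefZ mulVf // lead_coef_eq0.
  - split=> [|q q1 qf]; first by rewrite size_scale.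
    rewrite (eqp_rtrans (eqp_scale _ l0)).
    by have [_] := irr; apply => //; rewrite -(dvdpZr _ _ l0).
  - by rewrite dvdpZl.
move=> /not_implyP[q1 /not_implyP[qf /negP qNf]].
have q0 : q != 0 by apply: contraTneq qf => ->; rewrite dvd0p.
have sq : (size q < size f)%N.
  by rewrite ltn_neqAle dvdp_leq // andbT dvdp_size_eqp.
have [||p [mp irr pq]] := IH q.
- by rewrite -ltnS; apply: leq_trans sf.
- by rewrite ltn_neqAle eq_sym q1 size_poly_gt0.
by exists p; split=> //; exact: dvdp_trans pq qf.
Qed.

(** * Degrees of norms of polynomials *)

Section PolyNorm.
Variables (F : fieldType) (e c : F).
Hypothesis aniso : forall a b, norm2 e c a b = 0 -> a = 0 /\ b = 0.

Lemma coefM_top n (a b : {poly F}) : (size a <= n.+1)%N -> (size b <= n.+1)%N ->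
  (a * b)`_(n + n) = a`_n * b`_n.
Proof.
move=> sa sb; have lt : (n < (n + n).+1)%N by lia.
rewrite coefM (bigD1 (Ordinal lt)) //= addnK big1 ?addr0 // => i /eqP neq.
have [ni|ni] := ltnP n i; first by rewrite (nth_default _ (leq_trans sa ni)) mul0r.
rewrite (nth_default 0 (n := n + n - i)) ?mulr0 //; apply: leq_trans sb _.
suff : i != n :> nat by move=> /eqP; lia.
by apply/eqP => iE; apply: neq; apply: val_inj.
Qed.

(** The coefficient in degree [2n] is the norm of the pair of coefficients in degree [n], nonzero by
    anisotropy. So the degree is even, that is, the size is odd. *)
Lemma size_norm2 (a b : {poly F}) : a != 0 \/ b != 0 ->
  size (norm2 e%:P c%:P a b) = ((maxn (size a) (size b)).-1).*2.+1.
Proof.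
move=> ab; set n := (maxn _ _).-1.
have pos : (0 < maxn (size a) (size b))%N.
  by rewrite leq_max !size_poly_gt0; case: ab => ->; rewrite ?orbT.
have sa : (size a <= n.+1)%N by rewrite prednK // leq_maxl.
have sb : (size b <= n.+1)%N by rewrite prednK // leq_maxr.
have sM (x y : {poly F}) : (size x <= n.+1 -> size y <= n.+1 ->
    size (x * y)%R <= n.*2.+1)%N.
  by move=> sx sy; apply: leq_trans (size_polyMleq _ _) _; lia.
have sC (k : F) (x : {poly F}) : (size x <= n.*2.+1 -> size (k%:P * x)%R <= n.*2.+1)%N.
  by move=> sx; rewrite mul_polyC; apply: leq_trans (size_scale_leq _ _) sx.
have sN : (size (norm2 e%:P c%:P a b) <= n.*2.+1)%N.
  have sD (x y : {poly F}) : (size x <= n.*2.+1 -> size y <= n.*2.+1 ->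
      size (x + y)%R <= n.*2.+1)%N.
    by move=> sx sy; apply: leq_trans (size_polyD _ _) _; rewrite geq_max sx.
  by apply: (sD); [apply: (sD); [exact: sM|apply: (sC); exact: sM]|
    rewrite size_polyN; apply: (sC); exact: sM].
apply/eqP; rewrite eqn_leq sN /=; apply: contraT; rewrite -leqNgt => sN'.
have : (norm2 e%:P c%:P a b)`_(n + n) = 0 by rewrite nth_default // addnn.
rewrite coefB coefD !coefCM !coefM_top // => /aniso[an bn].
have [|] := leqP (size a) (size b) => [ab_le|ba_lt].
  have nE : n = (size b).-1 by rewrite /n (maxn_idPr ab_le).
  move: bn pos; rewrite nE (maxn_idPr ab_le) -lead_coefE => /eqP.
  by rewrite lead_coef_eq0 => /eqP ->; rewrite size_poly0.
have nE : n = (size a).-1 by rewrite /n (maxn_idPl (ltnW ba_lt)).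
move: an pos; rewrite nE (maxn_idPl (ltnW ba_lt)) -lead_coefE => /eqP.
by rewrite lead_coef_eq0 => /eqP ->; rewrite size_poly0.
Qed.

(* The two summands have degrees of different parities, so they cannot cancel. *)
Lemma norm_const (a0 a1 a2 a3 : {poly F}) :
  size (norm2 e%:P c%:P a0 a1 - 'X * norm2 e%:P c%:P a2 a3) = 1%N ->
  [/\ (size a0 <= 1)%N, (size a1 <= 1)%N, a2 = 0 & a3 = 0].
Proof.
have N00 : norm2 e%:P c%:P 0 0 = 0 by rewrite /norm2; ring.
have sX (p : {poly F}) : p != 0 -> size ('X * p) = (size p).+1.
  by move=> p0; rewrite mulrC size_mulX.
have [/andP[/eqP-> /eqP->]|a23] := boolP ((a2 == 0) && (a3 == 0)).
  rewrite N00 mulr0 subr0.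
  have [/andP[/eqP-> /eqP->]|a01] := boolP ((a0 == 0) && (a1 == 0)).
    by rewrite N00 size_poly0.
  rewrite size_norm2; last by apply/orP; rewrite -negb_and.
  by move=> s1; split=> //; lia.
have s23 := size_norm2 (a := a2) (b := a3).
have {}s23 : size ('X * norm2 e%:P c%:P a2 a3) = ((maxn (size a2) (size a3)).-1).*2.+2.
  rewrite sX ?s23 //; first by apply/orP; rewrite -negb_and.
  by rewrite -size_poly_gt0 s23 //; apply/orP; rewrite -negb_and.
have [/andP[/eqP-> /eqP->]|a01] := boolP ((a0 == 0) && (a1 == 0)).
  by rewrite N00 sub0r size_polyN s23.
have s01 : size (norm2 e%:P c%:P a0 a1) = ((maxn (size a0) (size a1)).-1).*2.+1.
  by apply: size_norm2; apply/orP; rewrite -negb_and.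
have [lt|gt|eq] := ltngtP (size (norm2 e%:P c%:P a0 a1)) (size ('X * norm2 e%:P c%:P a2 a3)).
- by rewrite addrC size_polyDl size_polyN // s23.
- rewrite size_polyDl ?size_polyN // s01 => s1.
  by move: gt; rewrite s01 s23; lia.
- by move: eq; rewrite s01 s23; lia.
Qed.

End PolyNorm.

(** * Primitive forms of quaternions and triviality of stabilisers *)

Section Stabiliser.
Variables (Fq : finFieldType) (c : Fq) (S : {set option Fq}).
Hypothesis hc : admissible c.
Hypothesis hS : placesB Fq \subset S.
Local Notation K := {fraction {poly Fq}}.
Local Notation frac := (@FracField.tofrac {poly Fq}).
Local Notation quatK := (@Quat _ (eK Fq) (constK c) (tK Fq)).

Lemma frac_exists (x : K) : exists n d : {poly Fq}, d != 0 /\ x = frac n / frac d.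
Proof.
by exists \n_(repr x), \d_(repr x); split; [exact: denom_ratioP|exact: frac_numden].
Qed.

Definition primitive4 (a0 a1 a2 a3 : {poly Fq}) : Prop :=
  forall p, irreducible_poly p -> ~~ [&& p %| a0, p %| a1, p %| a2 & p %| a3].

Lemma primitive4_exists (n0 n1 n2 n3 : {poly Fq}) :
  ~~ [&& n0 == 0, n1 == 0, n2 == 0 & n3 == 0] -> exists g a0 a1 a2 a3,
  [/\ g != 0, primitive4 a0 a1 a2 a3 &
    [/\ n0 = a0 * g, n1 = a1 * g, n2 = a2 * g & n3 = a3 * g]].
Proof.
move=> nz; pose g := gcdp (gcdp n0 n1) (gcdp n2 n3).
have g0 : g != 0.
  apply: contraNneq nz => /eqP; rewrite gcdp_eq0 !gcdp_eq0.
  by move=> /andP[/andP[-> ->] /andP[-> ->]].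
have gd n : (n \in [:: n0; n1; n2; n3]) -> g %| n.
  rewrite !inE => /or4P[] /eqP ->.
  - exact: dvdp_trans (dvdp_gcdl _ _) (dvdp_gcdl _ _).
  - exact: dvdp_trans (dvdp_gcdl _ _) (dvdp_gcdr _ _).
  - exact: dvdp_trans (dvdp_gcdr _ _) (dvdp_gcdl _ _).
  - exact: dvdp_trans (dvdp_gcdr _ _) (dvdp_gcdr _ _).
have /dvdpP[a0 E0] : g %| n0 by apply: gd; rewrite !inE eqxx.
have /dvdpP[a1 E1] : g %| n1 by apply: gd; rewrite !inE eqxx ?orbT.
have /dvdpP[a2 E2] : g %| n2 by apply: gd; rewrite !inE eqxx ?orbT.
have /dvdpP[a3 E3] : g %| n3 by apply: gd; rewrite !inE eqxx ?orbT.
exists g, a0, a1, a2, a3; split=> // p irr; apply/negP => /and4P[p0 p1 p2 p3].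
have : p * g %| g.
  rewrite {2}/g !dvdp_gcd {1}E0 {1}E1 {1}E2 {1}E3.
  by rewrite !dvdp_mul2r // p0 p1 p2 p3.
rewrite -{2}[g]mul1r dvdp_mul2r // dvdp1.
by have [sp _] := irr; move/eqP => s1; rewrite s1 in sp.
Qed.

Lemma primitive_form (w : D c) : nrd w != 0 -> exists f a0 a1 a2 a3,
  [/\ f != 0, primitive4 a0 a1 a2 a3 &
    w = f *: quatK (frac a0) (frac a1) (frac a2) (frac a3)].
Proof.
case: w => x0 x1 x2 x3.
have [n0 [d0 [d0_0 ->]]] := frac_exists x0; have [n1 [d1 [d1_0 ->]]] := frac_exists x1.
have [n2 [d2 [d2_0 ->]]] := frac_exists x2; have [n3 [d3 [d3_0 ->]]] := frac_exists x3.
pose d := d0 * d1 * d2 * d3; have d_0 : d != 0 by rewrite !mulf_neq0.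
have common n e (h : {poly Fq}) : e != 0 -> d = e * h -> frac n / frac e = (frac d)^-1 * frac (n * h).
  move=> e_0 dE; have hF0 : frac h != 0.
    by rewrite tofrac_eq0; apply: contraNneq d_0 => h0; rewrite dE h0 mulr0.
  by rewrite dE !tofracM invfM mulrACA (mulVf hF0) mulr1 mulrC.
have -> : quatK (frac n0 / frac d0) (frac n1 / frac d1) (frac n2 / frac d2) (frac n3 / frac d3) =
    (frac d)^-1 *: quatK (frac (n0 * (d1 * d2 * d3))) (frac (n1 * (d0 * d2 * d3)))
      (frac (n2 * (d0 * d1 * d3))) (frac (n3 * (d0 * d1 * d2))).
  by congr Quat; apply: common => //; rewrite /d; ring.
move: (n0 * _) (n1 * _) (n2 * _) (n3 * _) => m0 m1 m2 m3 w0.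
have [|g [a0 [a1 [a2 [a3 [g0 prim [-> -> -> ->]]]]]]] := @primitive4_exists m0 m1 m2 m3.
  apply: contraNN w0 => /and4P[/eqP-> /eqP-> /eqP-> /eqP->].
  by rewrite tofrac0 nrdZ /nrd /norm2 /= !(mulr0, mul0r, addr0, subr0, oppr0).
have dF0 : frac d != 0 by rewrite tofrac_eq0.
have gF0 : frac g != 0 by rewrite tofrac_eq0.
exists ((frac d)^-1 * frac g), a0, a1, a2, a3.
split; [exact: (mulf_neq0 (invr_neq0 dF0) gF0)|exact: prim|].
by clearbody d; apply: quatP; rewrite /= tofracM mulrA mulrAC.
Qed.

(** Some coordinate is prime to [p], and there the valuation is exactly that of [f]. *)
Lemma ord_primitive p n f a0 a1 a2 a3 : irreducible_poly p -> f != 0 ->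
  primitive4 a0 a1 a2 a3 ->
  qge (ord (Some p)) n (f *: quatK (frac a0) (frac a1) (frac a2) (frac a3)) ->
  n <= ord (Some p) f.
Proof.
move=> irr f0 prim [/= q0 q1 q2 q3].
have aux a : val_ge (ord (Some p)) n (f * frac a) -> ~~ (p %| a) -> n <= ord (Some p) f.
  move=> q pa; have a_0 : a != 0 by apply: contraNneq pa => ->; exact: dvdp0.
  have aF0 : frac a != 0 by rewrite tofrac_eq0.
  have := q; rewrite (vgeE _ _ (mulf_neq0 f0 aF0)) (ordM irr f0 aF0).
  by rewrite (ord_poly irr a_0) (multiplicity_eq0 irr a_0 pa) addr0.
have := prim p irr; rewrite !negb_and => /or4P[] pa.
- exact: aux q0 pa.
- exact: aux q1 pa.
- exact: aux q2 pa.
- exact: aux q3 pa.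
Qed.

Definition norm_poly (a0 a1 a2 a3 : {poly Fq}) : {poly Fq} :=
  norm2 (eFq Fq)%:P c%:P a0 a1 - 'X * norm2 (eFq Fq)%:P c%:P a2 a3.

Lemma nrd_poly a0 a1 a2 a3 :
  nrd (quatK (frac a0) (frac a1) (frac a2) (frac a3)) = frac (norm_poly a0 a1 a2 a3).
Proof.
rewrite /nrd /norm_poly /norm2 /= eKE /constK /tK.
by rewrite !(tofracD, tofracN, tofracM).
Qed.

(** The local hypothesis expresses through valuations on [K] that [w] fixes the standard vertex at
    [tau]: up to a scalar of valuation [n], [w] is a unit of the order. *)
Lemma stabiliser_scalar (w : D c) : congruence_unit S w ->
  (forall tau, tau != 0 -> Some tau \in S -> exists n,
    qge (ord (Some ('X - tau%:P))) n w /\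
    qge (ord (Some ('X - tau%:P))) (- n) (quat_inv w)) ->
  exists2 s, S_unit S s & w = s%:A.
Proof.
move=> [/orderA_unitE[w0 iw iV] [k k0 ku]] local.
have [f [a0 [a1 [a2 [a3 [f0 prim wE]]]]]] := primitive_form w0.
pose N := norm_poly a0 a1 a2 a3.
have nE : nrd w = f ^+ 2 * frac N by rewrite wE nrdZ nrd_poly.
have NF0 : frac N != 0 by apply: contraNneq w0 => NF0; rewrite nE NF0 mulr0.
have N0 : N != 0 by rewrite -tofrac_eq0.
have f20 : f ^+ 2 != 0 by exact: (expf_neq0 2 f0).
have ordN p : irreducible_poly p ->
    ord (Some p) (nrd w) = ord (Some p) f *+ 2 + (multiplicity p N)%:Z.
  move=> irr; rewrite nE (ordM irr f20 NF0) (ord_poly irr N0).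
  by rewrite (val_exp (ord_valuation irr) 2 f0).
(* For a suitable [n], both [p^-n w] and [p^n w^-1] are integral at [p]. Primitivity gives
   [n <= ord f], while the norm of the inverse bounds [2 ord f] plus the multiplicity of [p] in [N]
   by [2n]; so this multiplicity is 0. *)
have away p : p \is monic -> irreducible_poly p -> p != 'X -> ~~ (p %| N).
  move=> mp irr pX; have v := ord_valuation irr.
  have [n [qw qV]] : exists n, qge (ord (Some p)) n w /\ qge (ord (Some p)) (- n) (quat_inv w).
    have [out|] := pselect (outside S p).
      by exists 0; rewrite oppr0; split; [exact: (proj1 (orderAE hS w) iw p out)|
        exact: (proj1 (orderAE hS _) iV p out)].
    move=> nout; have [tau [tauS pE]] : exists tau, Some tau \in S /\ p = 'X - tau%:P.
      apply: contrapT => /forallNP no; apply: nout; split=> // a aS pE.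
      by apply: (no a).
    rewrite pE; apply: local => //; apply: contraNneq pX => tau0.
    by rewrite pE tau0 polyC0 subr0.
  have nf : n <= ord (Some p) f by rewrite wE in qw; exact: (ord_primitive irr f0 prim qw).
  have := nrd_ge v (eK_ge0 irr) (ord_poly_ge0 _ irr) (ord_poly_ge0 _ irr) qV.
  rewrite (nrd_inv w0) (vgeE _ _ (invr_neq0 w0)) (val_inv v w0) (ordN p irr) => le.
  have := multiplicity_gt0 irr N0; case: (p %| N) => // m0.
  by move: le nf m0; move: (ord _ f) => z; clear; lia.
have irrX := X_irreducible Fq; have vX := ord_valuation irrX.
pose m := k * f; have m0 : m != 0 by exact: (mulf_neq0 k0 f0).
have {}ku : one_unit (m *: quatK (frac a0) (frac a1) (frac a2) (frac a3) : D c).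
  by rewrite -scalerA -wE.
have [u0 u1 _ _] := ku.
have [ma0 oa0] := val_congr_one vX u0.
have aF0 : frac a0 != 0 by apply: contraNneq ma0 => aF0; rewrite /= aF0 mulr0.
have a00 : a0 != 0 by rewrite -tofrac_eq0.
(* Primitivity gives [ord m >= 0], and [m a0] is a unit at [t = 0]. *)
have om : ord (Some 'X) m = 0.
  have ge := ord_primitive irrX m0 prim (one_unit_qge ku).
  move: oa0; rewrite /= (ordM irrX m0 aF0) (ord_poly irrX a00).
  by move: ge; move: (ord _ m) => z; clear; lia.
(* Used once [a1] is known to be constant: a constant divisible by ['X] is 0. *)
have Xa1 : 'X %| a1.
  have [->|a10] := eqVneq a1 0; first exact: dvdp0.
  have a1F : frac a1 != 0 by rewrite tofrac_eq0.
  have := u1; rewrite /= (vgeE _ _ (mulf_neq0 m0 a1F)) (ordM irrX m0 a1F).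
  by rewrite om add0r (ord_poly irrX a10) lez_nat (multiplicity_gt0 irrX a10).
have XN : ~~ ('X %| N).
  have [_ oN] := val_congr_one vX (one_unit_nrd ku).
  move: oN; rewrite nrdZ nrd_poly (ordM irrX (expf_neq0 2 m0) NF0) (val_exp vX 2 m0) om.
  rewrite (ord_poly irrX N0) mul0rn add0r -(multiplicity_gt0 irrX N0).
  by case: multiplicity.
have sN : size N = 1%N.
  have [s1|s1] := leqP (size N) 1.
    by apply/eqP; rewrite eqn_leq s1 size_poly_gt0.
  have [p [mp irr pN]] := monic_irreducible_divisor s1.
  have [pX|pX] := eqVneq p 'X; first by rewrite -pX pN in XN.
  by have := away p mp irr pX; rewrite pN.
have [_ sa1 a20 a30] := norm_const (norm2_anisotropic hc) sN.
have a10 : a1 = 0.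
  apply/eqP; apply: contraT => a10; have := dvdp_leq a10 Xa1.
  by rewrite size_polyX; move: sa1; case: (size a1) => [|[]].
have sE : w = (f * frac a0)%:A.
  rewrite wE a10 a20 a30 tofrac0; apply: quatP => /=; rewrite ?mulr0 //.
  by rewrite mulr1.
exists (f * frac a0); last exact: sE.
have s0 : f * frac a0 != 0 by exact: (mulf_neq0 f0 aF0).
split; first exact: s0.
split; first by have [] := iw; rewrite sE /= mulr1.
have [+ _ _ _] := iV; rewrite sE (quat_inv_scale s0) ?nrd1 ?oner_neq0 //.
by rewrite quat_inv1 /= mulr1.
Qed.

Lemma coset_class_scalar s : S_unit S s -> coset_class S (s%:A : D c) = coset_class S 1.
Proof.
move=> sS; have [s0 _] := sS; apply/seteqP; split=> _ [k kS <-].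
  by exists (k * s); [exact: S_unitM|rewrite scalerA].
exists (k / s); first exact: (S_unitM hS kS (S_unitV sS)).
by rewrite scalerA (divfK s0).
Qed.

End Stabiliser.

(** * The group generated by the sets PA *)

Section GammaClasses.
Variables (Fq : finFieldType) (c : Fq) (S : {set option Fq}).
Hypothesis hS : placesB Fq \subset S.

Lemma constK_inj : injective (@constK Fq).
Proof. by move=> a b; rewrite !constKE => /fmorph_inj. Qed.

Lemma S0P (a : Fq) : Some a \in S0 S -> a != 0 /\ Some a \in S.
Proof.
rewrite /S0 finset.in_setD !finset.inE => /andP[+ ->]; rewrite negb_or => /andP[+ _].
by move=> neq; split=> //; apply: contraNneq neq => ->.
Qed.

Lemma mem_S0 (a : Fq) : a != 0 -> Some a \in S -> Some a \in S0 S.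
Proof.
move=> a0 aS; rewrite /S0 finset.in_setD aS andbT !finset.inE negb_or andbT.
by apply: contraNneq a0 => -[->].
Qed.

(** [alpha F = F conj(alpha)], and conjugation preserves the norm on [F_q[Z]], so the elements
    [1 + alpha F] are the elements [1 + F b] with [N b = 1 / tau]. *)
Lemma PAE tau : PA c S tau =
  [set coset_class S (neighbour c b.1 b.2) | b in
    [set b : Fq * Fq | norm2 (eFq Fq) c b.1 b.2 = tau^-1]].
Proof.
pose alpha a b : D c := (constK a)%:A + constK b *: ZD c.
have alphaF a b : 1 + alpha a b * FD c = neighbour c (a + eFq Fq * b) (- b).
  have kD : constK (a + eFq Fq * b) = constK a + eK Fq * constK b.
    by rewrite eKE !constKE rmorphD rmorphM.
  have kN : constK (- b) = - constK b by rewrite !constKE rmorphN.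
  by rewrite /neighbour kD kN; apply: quatP => /=; ring.
have alphaN a b : alpha a b * quat_conj (alpha a b) = (constK (norm2 (eFq Fq) c a b))%:A.
  rewrite mul_quat_conj -constK_norm2 /nrd /norm2 /alpha /=.
  by congr (_ *: 1); ring.
have normN a b : norm2 (eFq Fq) c (a + eFq Fq * b) (- b) = norm2 (eFq Fq) c a b.
  by rewrite /norm2; ring.
apply/seteqP; split=> [_ [_ [[a _ [b _ <-]] +] <-]|_ [[b0 b1] /= Nb <-]].
  rewrite -/(alpha a b) alphaN alphaF => Nab.
  exists (a + eFq Fq * b, - b) => //=; rewrite normN; apply: constK_inj.
  by have := congr1 (@coef1 _ _ _ _) Nab; rewrite /= !mulr1.
exists (alpha (b0 + eFq Fq * b1) (- b1)).
  split; first by exists (b0 + eFq Fq * b1) => //; exists (- b1).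
  by rewrite alphaN normN Nb.
by rewrite alphaF mulrN addrK opprK.
Qed.

(** The classes of congruence units form a subgroup containing the generators, hence containing the
    smallest one. *)
Lemma Gamma_congruence A : Gamma c S A ->
  exists2 w : D c, congruence_unit S w & A = coset_class S w.
Proof.
move=> /(smallest_sub (congruence_subgroup c hS)) sub.
have [|w Xw <-] := sub; last by exists w.
move=> A0 [tau /S0P[tau0 tauS]]; rewrite PAE => -[[b0 b1] /= Nb <-].
by exists (neighbour c b0 b1) => //; exact: neighbour_unit tauS Nb.
Qed.

(** [smallest] is an intersection; that it lies in [Lambda] requires one subgroup containing the
    generators, provided by the congruence units. *)
Lemma Gamma_subgroup : is_subgroup S (Gamma c S).
Proof.
split.
- by move=> A /Gamma_congruence[w [wA _] ->]; exists w.
- by move=> H [[]].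
- by move=> A B GA GB H HP; have [[_ _ HM _] _] := HP; apply: HM; [exact: GA|exact: GB].
- by move=> A GA H HP; have [[_ _ _ HV] _] := HP; apply: HV; exact: GA.
Qed.

Definition Gamma_unit (w : D c) : Prop := orderA_unit S w /\ Gamma c S (coset_class S w).

Lemma Gamma_unit_nrd w : Gamma_unit w -> nrd w != 0.
Proof. by case=> /orderA_unitE[]. Qed.

Lemma Gamma_unit1 : Gamma_unit 1.
Proof. by split; [exact: orderA_unit1|have [] := Gamma_subgroup]. Qed.

Lemma Gamma_unitM w w' : Gamma_unit w -> Gamma_unit w' -> Gamma_unit (w * w').
Proof.
move=> [wA wG] [wA' wG']; split; first exact: orderA_unitM.
by rewrite -coset_classM //; have [_ _ GM _] := Gamma_subgroup; exact: GM.
Qed.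

Lemma Gamma_unitV w : Gamma_unit w -> Gamma_unit (quat_inv w).
Proof.
move=> wG; have w0 := Gamma_unit_nrd wG; have [wA wC] := wG.
split; first exact: orderA_unitV.
by rewrite -(coset_classV _ w0); have [_ _ _ GV] := Gamma_subgroup; exact: GV.
Qed.

Lemma Gamma_unit_neighbour tau b0 b1 : Some tau \in S0 S ->
  norm2 (eFq Fq) c b0 b1 = tau^-1 -> Gamma_unit (neighbour c b0 b1).
Proof.
move=> tauS0 Nb; have [tau0 tauS] := S0P tauS0.
split; first by have [] := neighbour_unit hS tau0 tauS Nb.
apply: sub_gen_smallest; exists tau => //; rewrite PAE.
by exists (b0, b1).
Qed.

Lemma Gamma_class A : Gamma c S A -> exists2 w, Gamma_unit w & A = coset_class S w.
Proof.
move=> GA; have [w [wA _] AE] := Gamma_congruence GA.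
by exists w => //; split=> //; rewrite -AE.
Qed.

End GammaClasses.

(** * The action on the product of trees *)

Section MainTheorem.
Variables (Fq : finFieldType) (c : Fq).
Hypothesis hc : admissible c.
Variable S : {set option Fq}.
Hypothesis hS : placesB Fq \subset S.
Local Notation I := {P : option Fq | P \in S0 S}.
Variable Kv : forall i : I, completion (rational_place (val i)).
Variable phi : forall i : I, {lrmorphism Dv c (Kv i) -> 'M[Kv i]_2}.
Hypothesis phi_bij : forall i, bijective (phi i).

(** The default 0 is never taken, since [S0 S] omits the place [None] at infinity. *)
Definition place_param (i : I) : Fq := odflt 0 (val i).

Lemma place_paramE (i : I) : val i = Some (place_param i).
Proof.
case: i => -[a|] //= h; exfalso; move: h.
by rewrite /S0 finset.in_setD !finset.inE eqxx orbT.
Qed.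

Lemma place_param_S0 i : Some (place_param i) \in S0 S.
Proof. by rewrite -place_paramE; exact: valP. Qed.

Lemma place_param_neq0 i : place_param i != 0.
Proof. by have [] := S0P (place_param_S0 i). Qed.

Lemma place_param_inj : injective place_param.
Proof.
by move=> i j eq; apply: val_inj; rewrite !place_paramE eq.
Qed.

Lemma rational_placeE i : rational_place (val i) = Some ('X - (place_param i)%:P).
Proof. by rewrite place_paramE. Qed.

Lemma order_lattices : exists B : forall i, 'M[Kv i]_2, forall i, B i \in unitmx /\
  forall w : Dv c (Kv i), (forall j l,
    val_ge (@cval _ _ (Kv i)) 0 ((invmx (B i) *m phi i w *m B i) j l)) <->
    qge (@cval _ _ (Kv i)) 0 w.
Proof.
have ex i := local_order_lattice hc (rational_placeE i) (place_param_neq0 i) (phi_bij i).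
exists (fun i => s2val (cid2 (ex i))) => i.
by split; [exact: (s2valP (cid2 (ex i)))|exact: (s2valP' (cid2 (ex i)))].
Qed.

Variable B : forall i, 'M[Kv i]_2.
Hypothesis B_unit : forall i, B i \in unitmx.
Hypothesis B_order : forall i (w : Dv c (Kv i)), (forall j l,
  val_ge (@cval _ _ (Kv i)) 0 ((invmx (B i) *m phi i w *m B i) j l)) <->
  qge (@cval _ _ (Kv i)) 0 w.

Local Notation lval i := (@cval _ _ (Kv i)).

Definition loc i (w : D c) : Dv c (Kv i) := quat_map (cembed (Kv i)) w.
(** The translate by [w] of the standard vertex, whose components are the classes of the lattices
    spanned by the columns of [B i]. *)
Definition base_orbit (w : D c) : vertexT Kv := fun i => vertex (phi i) (B i) (loc i w).

Lemma locM i (w w' : D c) : loc i (w * w') = loc i w * loc i w'.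
Proof. exact: (quat_mapM (cembed (Kv i)) w w'). Qed.

Lemma locZ i k (w : D c) : loc i (k *: w) = cembed (Kv i) k *: loc i w.
Proof. exact: (quat_mapZ (cembed (Kv i)) k w). Qed.

Lemma loc1 i : loc i 1 = 1.
Proof. exact: (quat_map1 (cembed (Kv i))). Qed.

Lemma nrd_loc i (w : D c) : nrd (loc i w) = cembed (Kv i) (nrd w).
Proof. exact: (nrd_map (cembed (Kv i))). Qed.

Lemma nrd_loc_neq0 i (w : D c) : nrd w != 0 -> nrd (loc i w) != 0.
Proof. by move=> w0; rewrite nrd_loc fmorph_eq0; exact: w0. Qed.

Lemma loc_inv i (w : D c) : nrd w != 0 -> loc i (quat_inv w) = quat_inv (loc i w).
Proof. exact: (quat_map_inv (cembed (Kv i)) (x := w)). Qed.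

Lemma act_vertices (w : D c) (g : forall i, Dv c (Kv i)) :
  act phi (coset_class S w) (fun i => vertex (phi i) (B i) (g i)) =
  (fun i => vertex (phi i) (B i) (loc i w * g i)).
Proof.
apply: functional_extensionality_dep => i; rewrite vertex_image /act.
apply/seteqP; split=> [_ [_ [k kS <-] [L Lg <-]]|_ [L Lg <-]]; last first.
  by exists w; [exact: class_self|exists L].
have [k0 _] := kS; have kv0 : cembed (Kv i) k != 0 by rewrite fmorph_eq0; exact: k0.
move: Lg; rewrite vertexE => -[l /= l0 <-].
(* The scalar by which the representative differs from [w] is absorbed into the homothety factor of
   the lattice. *)
exists (lattice (phi i) (B i) ((l * cembed (Kv i) k) *: g i)).
  by exists (l * cembed (Kv i) k) => //=; exact: mulf_neq0.
rewrite -/(loc i (k *: w)) -!lattice_image locZ.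
by congr lattice; rewrite -scalerAl -!scalerAr scalerA mulrC.
Qed.

Lemma act_base_orbit (w w' : D c) :
  act phi (coset_class S w) (base_orbit w') = base_orbit (w * w').
Proof.
rewrite act_vertices; apply: functional_extensionality_dep => i.
by rewrite /base_orbit locM.
Qed.

Lemma base_orbit_vertex (w : D c) : nrd w != 0 -> T_vertex (base_orbit w).
Proof.
move=> w0 i; apply/(tree_vertexP (phi_bij i) (B_unit i)).
by exists (loc i w); [exact: nrd_loc_neq0|].
Qed.

Lemma base_stabiliser (w : D c) : Gamma_unit S w -> base_orbit w = base_orbit 1 ->
  coset_class S w = coset_class S 1.
Proof.
(* The class is represented anew by an element [u] satisfying the congruence at [t = 0], which rules
   out nontrivial constants of [F_q[Z]]. *)
move=> [_ wG] fix_w; have [u uX uE] := Gamma_congruence hS wG.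
have fix_u : base_orbit u = base_orbit 1.
  by rewrite -[u]mulr1 -act_base_orbit -uE act_base_orbit mulr1.
have u0 : nrd u != 0 by have [/orderA_unitE[]] := uX.
rewrite uE; suff [s sS ->] : exists2 s, S_unit S s & u = s%:A.
  exact: coset_class_scalar.
apply: (stabiliser_scalar hc hS uX) => tau tau0 tauS.
pose i : I := exist _ (Some tau) (mem_S0 tau0 tauS).
have := congr1 (fun P => P i) fix_u; rewrite /base_orbit loc1.
move=> /(vertex_stabiliser (B_unit i) (@B_order i) (nrd_loc_neq0 i u0)).
move=> [k [k0 ik]]; rewrite (quat_inv_scale k0 (nrd_loc_neq0 i u0)) -(loc_inv i u0) => iV.
have bound (l : Kv i) (x : {fraction {poly Fq}}) : l != 0 -> val_ge (lval i) 0 (l * cembed (Kv i) x) ->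
    val_ge (ord (Some ('X - tau%:P))) (- lval i l) x.
  move=> l0; have [->|x0] := eqVneq x 0; first by left.
  have ex0 : cembed (Kv i) x != 0 by rewrite fmorph_eq0.
  rewrite (vgeE _ _ (mulf_neq0 l0 ex0)) (val_mul (completion_valuation _) l0 ex0).
  rewrite (cval_embed (Kv i) x0) => ge; right; move: ge.
  by rewrite -[rational_place (val i)]/(Some ('X - tau%:P)); move: (ord _ x) => z; clear; lia.
(* [k u] and its inverse are integral, so [u] has valuation at least [- v(k)] and its inverse at
   least [v(k)]. *)
exists (- lval i k); split.
  by case: ik => ? ? ? ?; split; apply: bound.
have -> : - - lval i k = - lval i k^-1 by rewrite (val_inv (completion_valuation _) k0).
have kV0 : k^-1 != 0 by rewrite invr_eq0.
by case: iV => ? ? ? ?; split; apply: (bound k^-1 _ kV0).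
Qed.

Lemma transitive_integral n (g : forall i, Dv c (Kv i)) :
  (forall i, qge (lval i) 0 (g i)) -> (forall i, nrd (g i) != 0) ->
  (\sum_i `|lval i (nrd (g i))| <= n)%N ->
  exists2 w, Gamma_unit S w & forall i,
    vertex (phi i) (B i) (g i) = vertex (phi i) (B i) (loc i w).
Proof.
have vK i := completion_valuation (Kv i).
have ei i := local_e_integral (Kv i) (rational_placeE i).
have ci i := local_c_integral c (Kv i) (rational_placeE i).
have ti i := local_t_integral (Kv i) (rational_placeE i) (place_param_neq0 i).
(* When all norms are units, each [h i] is a unit of the order and fixes the standard vertex. *)
have base (h : forall i, Dv c (Kv i)) : (forall i, qge (lval i) 0 (h i)) ->
    (forall i, nrd (h i) != 0) -> (forall i, lval i (nrd (h i)) = 0) ->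
    exists2 w, Gamma_unit S w & forall i,
      vertex (phi i) (B i) (h i) = vertex (phi i) (B i) (loc i w).
  move=> ih h0 vh; exists 1; first exact: Gamma_unit1.
  move=> i; rewrite loc1 -[h i]mul1r.
  apply: (vertex_unit (B_unit i) (@B_order i)); [exact: h0|exact: ih|].
  exact: (qge_quat_inv (vK i) (ei i) (h0 i) (vh i) (ih i)).
elim: n g => [|n IH] g ig g0 sn.
  apply: base => // i; move: sn.
  by rewrite leqn0 sum_nat_eq0 => /forallP/(_ i); rewrite absz_eq0 => /eqP.
have [all0|/existsNP[i /eqP vi]] := pselect (forall i, lval i (nrd (g i)) = 0).
  exact: base.
have vge0 j : 0 <= lval j (nrd (g j)).
  by have := nrd_ge (vK j) (ei j) (ci j) (ti j) (ig j); rewrite (vgeE _ _ (g0 j)).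
have vgt0 : 0 < lval i (nrd (g i)) by rewrite lt_neqAle eq_sym vi vge0.
have [s [step vs qs]] := step_exists hc (rational_placeE i) (place_param_neq0 i) (ig i) (g0 i) vgt0.
have sI j := step_integral (Kv j) (rational_placeE j) (place_param_neq0 i) step.
have s0 j : nrd (loc j s) != 0 by have [] := sI j.
pose g' j : Dv c (Kv j) := quat_inv (loc j s) * g j.
(* At the places other than [i] the norm of [s] is a unit, so the exponent is 0 and integrality
   suffices. *)
have step_j j : qge (lval j) (lval j (nrd (loc j s))) (quat_conj (loc j s) * g j).
  have [ji|/eqP ji] := pselect (i = j); first by case: j / ji.
  have [_ is_ vj] := sI j; rewrite vj; last by apply: contra_neq ji => /place_param_inj.
  apply: (qgeM0 (vK j) (ei j) (ci j) (ti j)) => //.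
  exact: (qge_conj (vK j) (ei j)).
have g'P j : qge (lval j) 0 (g' j) /\
    lval j (nrd (g' j)) = lval j (nrd (g j)) - lval j (nrd (loc j s)).
  exact: (quat_inv_mul_ge (vK j) (s0 j) (g0 j) (step_j j)).
have g'0 j : nrd (g' j) != 0.
  by apply: nrdM_neq0; [exact: nrd_inv_neq0|].
have vs0 j : 0 <= lval j (nrd (loc j s)).
  have [_ is_ _] := sI j.
  by have := nrd_ge (vK j) (ei j) (ci j) (ti j) is_; rewrite (vgeE _ _ (s0 j)).
have v'0 j : 0 <= lval j (nrd (g' j)).
  by have := nrd_ge (vK j) (ei j) (ci j) (ti j) (proj1 (g'P j)); rewrite (vgeE _ _ (g'0 j)).
have [|||w wG wE] := IH g'.
- by move=> j; exact: (proj1 (g'P j)).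
- exact: g'0.
- rewrite -ltnS; apply: leq_trans sn.
  rewrite (bigD1 i) //= [ltnRHS](bigD1 i) //= -addSn; apply: leq_add.
    have := v'0 i; have : 0 < lval i (nrd (loc i s)) := vs.
    by have [_ ->] := g'P i; move: (lval i _) (lval i _) => a b; clear; lia.
  apply: leq_sum => j _; have := v'0 j; have := vs0 j.
  by have [_ ->] := g'P j; move: (lval j _) (lval j _) => a b; clear; lia.
have gE j : vertex (phi j) (B j) (g j) = vertex (phi j) (B j) (loc j (s * w)).
  rewrite locM vertex_image -wE -vertex_image /g' mulrA mul_quat_inv // mul1r.
  by [].
(* The scalar step changes no vertex, so [w] itself still works; otherwise [s] represents a
   generator and is multiplied onto [w]. *)
case: step => [sE|[b0 [b1 [Nb sE]]]].
  exists w => // j; rewrite gE sE -scalerAl mul1r locZ vertexZ //.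
  by rewrite fmorph_eq0 tK_sub_neq0.
exists (s * w); last exact: gE.
apply: (Gamma_unitM hS) => //; rewrite sE.
exact: (Gamma_unit_neighbour hS (place_param_S0 i) Nb).
Qed.

Lemma vertices_transitive P : T_vertex P -> exists2 w, Gamma_unit S w & P = base_orbit w.
Proof.
move=> TP.
have ex i : exists g : Dv c (Kv i), [/\ qge (lval i) 0 g, nrd g != 0 &
    P i = vertex (phi i) (B i) g].
  have [g g0 PE] := proj1 (tree_vertexP (phi_bij i) (B_unit i) _) (TP i).
  (* A power of the uniformiser clears denominators without changing the homothety class. *)
  have [k k0 ik] := exists_integral_multiple (completion_valuation (Kv i)) g
    (local_pi (place_param i) (Kv i)) (val_local_pi (Kv i) (rational_placeE i)).
  by exists (k *: g); split; [|exact: nrdZ_neq0|rewrite vertexZ].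
pose g i := sval (cid (ex i)).
have gP i : [/\ qge (lval i) 0 (g i), nrd (g i) != 0 & P i = vertex (phi i) (B i) (g i)].
  exact: svalP (cid (ex i)).
have [|||w wG wE] := @transitive_integral (\sum_i `|lval i (nrd (g i))|)%N g.
- by move=> i; have [] := gP i.
- by move=> i; have [] := gP i.
- by [].
exists w => //; apply: functional_extensionality_dep => i.
by have [_ _ ->] := gP i; rewrite wE.
Qed.

Lemma base_orbit_inj (w w' : D c) : Gamma_unit S w -> Gamma_unit S w' ->
  base_orbit w = base_orbit w' -> coset_class S w = coset_class S w'.
Proof.
move=> wG wG' eq; have w0 := Gamma_unit_nrd wG'.
have vG := Gamma_unitV hS wG'.
have : coset_class S (quat_inv w' * w) = coset_class S 1.
  apply: base_stabiliser; first exact: (Gamma_unitM hS vG wG).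
  by rewrite -act_base_orbit eq act_base_orbit (mul_inv_quat w0).
move=> /(congr1 (class_mul (coset_class S w'))); rewrite !coset_classM //.
by rewrite mulrA (mul_quat_inv w0) mul1r mulr1.
Qed.

Lemma Gamma_simply_transitive : simply_transitive phi (Gamma c S).
Proof.
move=> P Q /vertices_transitive[u uG ->] /vertices_transitive[w wG ->].
have u0 := Gamma_unit_nrd uG; have uV := Gamma_unitV hS uG.
(* The two vertices are the translates of the standard one by [u] and by [w]. *)
exists (coset_class S (w * quat_inv u)); split.
  split; first by have [] := Gamma_unitM hS wG uV.
  by rewrite act_base_orbit -mulrA (mul_inv_quat u0) mulr1.
move=> _ [/(Gamma_class hS)[h hG ->]]; rewrite act_base_orbit => eq.
have := base_orbit_inj wG (Gamma_unitM hS hG uG) (esym eq).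
move=> /(congr1 (fun A => class_mul A (coset_class S (quat_inv u)))); rewrite /= !coset_classM //.
by rewrite -(mulrA h) (mul_quat_inv u0) mulr1.
Qed.

(** Transitivity leaves a single orbit and freeness a stabiliser of order 1, so the sum is the
    single term 1/1. *)
Lemma Gamma_degree : N0 phi (Gamma c S) = 1.
Proof.
have T1 : T_vertex (base_orbit 1) by apply: base_orbit_vertex; rewrite nrd1 oner_neq0.
have orbit P : T_vertex P -> vertex_orbit phi (Gamma c S) P = @T_vertex Fq S Kv.
  move=> TP; apply/seteqP; split=> [_ [A GA <-]|Q TQ]; last first.
    by have [A [[GA AE] _]] := Gamma_simply_transitive TP TQ; exists A.
  have [h hG ->] := Gamma_class hS GA; have [u uG ->] := vertices_transitive TP.
  rewrite act_base_orbit; apply: base_orbit_vertex.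
  exact: Gamma_unit_nrd (Gamma_unitM hS hG uG).
have quotE : quotient_vertex phi (Gamma c S) = [set @T_vertex Fq S Kv].
  apply/seteqP; split=> [_ [P TP <-]|_ ->]; first exact: orbit.
  by exists (base_orbit 1); [|exact: orbit].
rewrite /N0 quotE fsbig_set1; set P := xget _ _.
have TP : T_vertex P by apply: (xgetI _ T1).
suff -> : stabiliser phi (Gamma c S) P = [set coset_class S 1].
  by rewrite fset_set1 cardfs1 invr1.
(* Uniqueness for the pair [P], [P] identifies every stabilising class with the trivial one. *)
have [A [_ uniq]] := Gamma_simply_transitive TP TP.
have one : stabiliser phi (Gamma c S) P (coset_class S 1).
  split; first by have [] := Gamma_unit1 c hS.
  by have [u uG ->] := vertices_transitive TP; rewrite act_base_orbit mul1r.
apply/seteqP; split=> [A' GA'|_ ->]; last exact: one.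
by rewrite -(uniq _ GA'); exact: uniq.
Qed.

End MainTheorem.

Theorem corollary2p23 (Fq : finFieldType) (c : Fq) (hc : admissible c)
    (S : {set option Fq}) (hS : placesB Fq \subset S)
    (Kv : forall i : {P : option Fq | P \in S0 S}, completion (rational_place (val i)))
    (phi : forall i : {P : option Fq | P \in S0 S},
      {lrmorphism Dv c (Kv i) -> 'M[Kv i]_2})
    (phi_bij : forall i : {P : option Fq | P \in S0 S}, bijective (phi i)) :
  N0 phi (Gamma c S) = 1 /\ simply_transitive phi (Gamma c S).
Proof.
have [B BP] := order_lattices hc phi_bij.
have B_unit i := proj1 (BP i); have B_order i := proj2 (BP i).
by split; [exact: (Gamma_degree hc hS phi_bij B_unit B_order)|
  exact: (Gamma_simply_transitive hc hS phi_bij B_unit B_order)].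
Qed.
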